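(* Let $(E,\mathcal E)$ be a countably generated measurable space and $V:E\to(0,+\infty)$ a measurable function. Let $P$ and $Q$ be kernels from $E$ to $L^\infty(V)$ such that $0\le P\le Q$. Then $r_{\mathrm{ess}}(P)\le r_{\mathrm{ess}}(Q)$.
   Context: $L^\infty(V)$ is the space of measurable functions $f:E\to\mathbb C$ for which there is $C>0$ with $|f(x)|\le C\,V(x)$ for all $x\in E$, endowed with the norm $\|f\|_V=\sup_{x\in E}|f(x)|/V(x)$ (functions are not identified up to null sets). A kernel on $E$ is a map $R:E\times\mathcal E\to[0,+\infty]$ such that $R(x,\cdot)$ is a $\sigma$-finite measure for every $x\in E$ and $R(\cdot,A)$ is measurable for every $A\in\mathcal E$. For a kernel $R$, write $Rf(x)=\int_E f(y)\,R(x,\mathrm dy)$. A kernel from $E$ to $L^\infty(V)$ is a kernel $R$ with $\|RV\|_V<\infty$; it induces a bounded linear operator on $L^\infty(V)$. $0\le P\le Q$ means $0\le Pf\le Qf$ pointwise for all $f\in L^\infty(V)$ with $f\ge 0$. The essential spectral radius of the kernel is that of the induced operator on $B=L^\infty(V)$, namely $$r_{\mathrm{ess}}(R):=\lim_{n\to\infty}\inf\{\|R^n-K\|^{1/n}:K\in\mathcal K(B)\},$$ where $\mathcal K(B)$ is the set of compact operators on $B$ and $\|\cdot\|$ is the operator norm. *)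

(* Defs.v *)
From HB Require Import structures.
From mathcomp Require Import all_boot all_order all_algebra.
From mathcomp Require Import all_classical all_reals all_analysis.
From mathcomp Require Import measurable_realfun complex.

Set Implicit Arguments.
Unset Strict Implicit.
Unset Printing Implicit Defensive.
Import Order.TTheory GRing.Theory Num.Theory.
Import numFieldNormedType.Exports.

Local Open Scope classical_set_scope.
Local Open Scope ring_scope.
Local Open Scope complex_scope.

Definition countably_generated d (E : measurableType d) : Prop :=
  exists2 G : set (set E), countable G & @measurable d E = <<s G >>.

(* Measurability with respect to the Borel sigma-algebra of the complex
   plane; R[i]^o carries the topology of the modulus. *)
Definition cmeasurable d (E : measurableType d) (R : realType)
    (f : E -> R[i]) : Prop :=
  measurable_fun [set: E] (f : E -> g_sigma_algebraType (@open R[i]^o)).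

Section cmeasurable_ReIm.
Context d (E : measurableType d) (R : realType).
Implicit Types (f : E -> R[i]) (z w : R[i]).

Lemma normc_ge_absRe z : `|complex.Re z| <= Normc.normc z.
Proof. by have := normc_ge_Re z; rewrite lecR. Qed.

Lemma normc_ge_absIm z : `|complex.Im z| <= Normc.normc z.
Proof.
case: z => a b /=; rewrite -sqrtr_sqr ler_wsqrtr// lerDr sqr_ge0 //.
Qed.

Lemma normc_le_absD z : Normc.normc z <= `|complex.Re z| + `|complex.Im z|.
Proof.
case: z => a b /=.
have s0 : 0 <= `|a| + `|b| by rewrite addr_ge0.
rewrite -[leRHS]ger0_norm// -sqrtr_sqr ler_wsqrtr//.
rewrite sqrrD !real_normK ?num_real// addrAC lerDl mulrn_wge0// mulr_ge0//.
Qed.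

Lemma normc_ge0 z : 0 <= Normc.normc z.
Proof. exact: le_trans (normc_ge_absRe z). Qed.

Lemma open_gtRe (a : R) : @open R[i]^o [set z | a < complex.Re z].
Proof.
rewrite openE => z /= az; apply/nbhs_ballP.
exists ((complex.Re z - a)%:C) => /=; first by rewrite ltcR subr_gt0.
move=> w; rewrite -ball_normE /= ltcR => zw.
have := le_lt_trans (normc_ge_absRe _) zw.
move/(le_lt_trans (ler_norm _)); case: z az {zw} => x y /=; case: w => x' y' /=.
by move=> _; rewrite ltrD2l ltrN2.
Qed.

Lemma open_gtIm (a : R) : @open R[i]^o [set z | a < complex.Im z].
Proof.
rewrite openE => z /= az; apply/nbhs_ballP.
exists ((complex.Im z - a)%:C) => /=; first by rewrite ltcR subr_gt0.
move=> w; rewrite -ball_normE /= ltcR => zw.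
have := le_lt_trans (normc_ge_absIm _) zw.
move/(le_lt_trans (ler_norm _)); case: z az {zw} => x y /=; case: w => x' y' /=.
by move=> _; rewrite ltrD2l ltrN2.
Qed.

Lemma cmeasurableP f : cmeasurable f <->
  measurable_fun [set: E] (fun x => complex.Re (f x)) /\
  measurable_fun [set: E] (fun x => complex.Im (f x)).
Proof.
split=> [mf|[mRe mIm]].
  have mo (U : set R[i]) : @open R[i]^o U -> measurable (f @^-1` U).
    by move=> oU; rewrite -[_ @^-1` _]setTI; apply: mf => //; exact: sub_sigma_algebra.
  split; move=> mT; apply: (measurability _ (RGenOInfty.measurableE R)) => //.
  - move=> _ [_ [a ->] <-]; rewrite setTI.
    rewrite (_ : _ @^-1` _ = f @^-1` [set z | a < complex.Re z]).
      by apply: mo; exact: open_gtRe.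
    by apply/seteqP; split=> x /=; rewrite in_itv/= andbT.
  - move=> _ [_ [a ->] <-]; rewrite setTI.
    rewrite (_ : _ @^-1` _ = f @^-1` [set z | a < complex.Im z]).
      by apply: mo; exact: open_gtIm.
    by apply/seteqP; split=> x /=; rewrite in_itv/= andbT.
apply: (@measurability _ _ _ (g_sigma_algebraType (@open R[i]^o)) _ f
  (@open R[i]^o)) => //.
move=> _ [U oU <-].
pose box (q : (rat * rat) * (rat * rat)) : set R[i] :=
  [set z | (ratr q.1.1 < complex.Re z < ratr q.1.2) &&
           (ratr q.2.1 < complex.Im z < ratr q.2.2)].
have -> : U = \bigcup_(q in [set q | box q `<=` U]) box q.
  apply/seteqP; split=> [z Uz|z [q /= qU /qU//]].
  move: oU; rewrite openE => /(_ z Uz) /nbhs_ballP[e /= e0 eU].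
  have eE : e = (complex.Re e)%:C by rewrite RRe_real// gtr0_real.
  set r := complex.Re e in eE.
  have r0 : 0 < r by move: e0; rewrite eE ltcR.
  have h0 : 0 < r / 2 by rewrite divr_gt0.
  have /rat_in_itvoo[a] : complex.Re z - r / 2 < complex.Re z by rewrite ltrBlDr ltrDl.
  have /rat_in_itvoo[b] : complex.Re z < complex.Re z + r / 2 by rewrite ltrDl.
  have /rat_in_itvoo[c] : complex.Im z - r / 2 < complex.Im z by rewrite ltrBlDr ltrDl.
  have /rat_in_itvoo[d'] : complex.Im z < complex.Im z + r / 2 by rewrite ltrDl.
  rewrite !in_itv/= => /andP[d1 d2] /andP[c1 c2] /andP[b1 b2] /andP[a1 a2].
  exists ((a, b), (c, d')) => /=; last by rewrite /box/= a2 b1 c2 d1.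
  move=> w /= /andP[/andP[w1 w2] /andP[w3 w4]]; apply: eU.
  rewrite -ball_normE /= eE ltcR (le_lt_trans (normc_le_absD _))//.
  have -> : complex.Re (z - w) = complex.Re z - complex.Re w by case: (z) (w) => ? ? [].
  have -> : complex.Im (z - w) = complex.Im z - complex.Im w by case: (z) (w) => ? ? [].
  rewrite [ltRHS]splitr ltrD// ltr_distlC.
    by rewrite (lt_trans a1 w1) (lt_trans w2 b2).
  by rewrite (lt_trans c1 w3) (lt_trans w4 d2).
rewrite setTI preimage_bigcup bigcup_mkcond.
apply: countable_bigcupT_measurable => [|q]; first exact: countableP.
case: ifPn => // _.
rewrite (_ : _ @^-1` _ =
  ((fun x => complex.Re (f x)) @^-1` `]ratr q.1.1, ratr q.1.2[%classic) `&`
  ((fun x => complex.Im (f x)) @^-1` `]ratr q.2.1, ratr q.2.2[%classic)).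
  by apply: measurableI; rewrite -[_ @^-1` _]setTI; [apply: mRe|apply: mIm].
by apply/seteqP; split=> x /=; rewrite !in_itv/= => /andP.
Qed.

End cmeasurable_ReIm.

Record weight d (E : measurableType d) (R : realType) := Weight {
  weight_fun :> E -> R;
  measurable_weight : measurable_fun [set: E] weight_fun;
  weight_gt0 : forall x, 0 < weight_fun x }.

Section Linfty.
Context d (E : measurableType d) (R : realType) (V : weight E R).

(* Functions are not identified up to null sets. *)
Definition Linfty_pred : {pred E -> R[i]^o} := fun f =>
  `[< cmeasurable f /\
      exists2 C, 0 < C & forall x, Normc.normc (f x) <= C * V x >].

Record Linfty := MkLinfty {
  Linfty_fun :> E -> R[i]^o;
  Linfty_funP : Linfty_fun \in Linfty_pred }.

HB.instance Definition _ := [isSub for Linfty_fun].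
HB.instance Definition _ := [Choice of Linfty by <:].

Lemma Linfty_submod_closed : submod_closed Linfty_pred.
Proof.
split=> [|a f g].
  apply/asboolP; split; first exact: measurable_cst.
  by exists 1 => // x; rewrite Normc.normc0 mul1r ltW// weight_gt0.
move=> /asboolP[/cmeasurableP[fR fI] [C C0 fC]].
move=> /asboolP[/cmeasurableP[gR gI] [D D0 gD]].
apply/asboolP; split.
  apply/cmeasurableP; split.
  - rewrite [X in measurable_fun _ X](_ : _ = fun x =>
      complex.Re a * complex.Re (f x) - complex.Im a * complex.Im (f x)
      + complex.Re (g x)).
      by apply: measurable_funD => //; apply: measurable_funB => //;
        apply: measurable_funM.
    apply/funext => x; rewrite !fctE /GRing.scale/=.
    by case: a (f x) (g x) => ? ? [? ?] [].
  - rewrite [X in measurable_fun _ X](_ : _ = fun x =>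
      complex.Re a * complex.Im (f x) + complex.Im a * complex.Re (f x)
      + complex.Im (g x)).
      by apply: measurable_funD => //; apply: measurable_funD => //;
        apply: measurable_funM.
    apply/funext => x; rewrite !fctE /GRing.scale/=.
    by case: a (f x) (g x) => ? ? [? ?] [].
exists (Normc.normc a * C + D).
  by rewrite ltr_wpDl// mulr_ge0// ?normc_ge0// ltW.
move=> x; rewrite !fctE (le_trans (le_normcD _ _))// mulrDl lerD//.
by rewrite Normc.normcM -mulrA ler_wpM2l// normc_ge0.
Qed.

HB.instance Definition _ :=
  GRing.isSubmodClosed.Build _ _ Linfty_pred Linfty_submod_closed.
HB.instance Definition _ := [SubChoice_isSubLmodule of Linfty by <:].

Definition Vnorm (f : Linfty) : R :=
  sup [set Normc.normc (f x) / V x | x in [set: E]].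

Lemma Linfty_has_sup (f : Linfty) :
  has_sup [set Normc.normc (f x) / V x | x in [set: E]].
Proof.
split; first by exists (Normc.normc (f point) / V point), point.
have /asboolP[_ [C C0 fC]] := Linfty_funP f.
by exists C => _ [x _ <-]; rewrite ler_pdivrMr ?weight_gt0.
Qed.

Lemma le_Vnorm (f : Linfty) x : Normc.normc (f x) <= Vnorm f * V x.
Proof.
rewrite -ler_pdivrMr ?weight_gt0//; apply: sup_upper_bound.
  exact: Linfty_has_sup.
by exists x.
Qed.

Lemma Vnorm_le (f : Linfty) C :
  (forall x, Normc.normc (f x) <= C * V x) -> Vnorm f <= C.
Proof.
move=> fC; apply: ge_sup; first by exists (Normc.normc (f point) / V point), point.
by move=> _ [x _ <-]; rewrite ler_pdivrMr ?weight_gt0.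
Qed.

Lemma Vnorm_ge0 (f : Linfty) : 0 <= Vnorm f.
Proof.
rewrite -(@pmulr_lge0 _ (V point)) ?weight_gt0//.
exact: (le_trans (normc_ge0 _) (le_Vnorm f point)).
Qed.

(* The norm of a normed module over R[i] takes its values in R[i]. *)
Definition Vnorm_C (f : Linfty) : R[i] := (Vnorm f)%:C.

Lemma Vnorm_CD (f g : Linfty) : Vnorm_C (f + g) <= Vnorm_C f + Vnorm_C g.
Proof.
rewrite /Vnorm_C -rmorphD /= lecR; apply: Vnorm_le => x.
rewrite (le_trans (le_normcD _ _))// mulrDl.
by rewrite lerD// le_Vnorm.
Qed.

Lemma Vnorm_CZ (a : R[i]) (f : Linfty) : Vnorm_C (a *: f) = `|a| * Vnorm_C f.
Proof.
have le b (g : Linfty) : Vnorm (b *: g) <= Normc.normc b * Vnorm g.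
  apply: Vnorm_le => x.
  by rewrite Normc.normcM -mulrA ler_wpM2l ?normc_ge0// le_Vnorm.
rewrite /Vnorm_C -[`|a|]/((Normc.normc a)%:C) -rmorphM /=; congr (_%:C).
apply/eqP; rewrite eq_le le /=.
have [->|a0] := eqVneq a 0; first by rewrite Normc.normc0 mul0r Vnorm_ge0.
have na0 : 0 < Normc.normc a.
  rewrite lt_neqAle normc_ge0 andbT eq_sym.
  by apply: contra a0 => /eqP/Normc.eq0_normc ->.
rewrite mulrC -ler_pdivlMr// mulrC -Normc.normcV.
by have := le a^-1 (a *: f); rewrite scalerA mulVf// scale1r.
Qed.

Lemma Vnorm_C_eq0 (f : Linfty) : Vnorm_C f = 0 -> f = 0.
Proof.
move=> /complexI f0; apply: val_inj; apply/funext => x /=.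
apply: Normc.eq0_normc; apply/eqP; rewrite eq_le normc_ge0 andbT.
by rewrite (le_trans (le_Vnorm f x))// f0 mul0r.
Qed.

HB.instance Definition _ :=
  Lmodule_isNormed.Build R[i] Linfty Vnorm_CD Vnorm_CZ Vnorm_C_eq0.

Lemma Linfty_normE (f : Linfty) : `|f| = (Vnorm f)%:C.
Proof. by []. Qed.

End Linfty.

Section kernel_operator.
Context d (E : measurableType d) (R : realType) (V : weight E R).

(* The weighted sup norm of the [0, +oo]-valued function k V is finite. *)
Definition kernel_to_Linfty (k : R.-sigmafker E ~> E) : Prop :=
  (ereal_sup [set (\int[k x]_y (V y)%:E) * ((V x)^-1)%:E | x in [set: E]]
     < +oo)%E.

Definition kint (k : R.-sigmafker E ~> E) (f : E -> R[i]) (x : E) : R[i] :=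
  (\int[k x]_y complex.Re (f y)) +i* (\int[k x]_y complex.Im (f y)).

Variables (k : R.-sigmafker E ~> E) (kV : kernel_to_Linfty k).

Lemma kernel_bound :
  exists2 M : R, 0 < M & forall x, (\int[k x]_y (V y)%:E <= (M * V x)%:E)%E.
Proof.
move: kV; rewrite /kernel_to_Linfty; set s := ereal_sup _ => soo.
have le x : (\int[k x]_y (V y)%:E * ((V x)^-1)%:E <= s)%E.
  by apply: ereal_sup_ubound; exists x.
have i0 x : (0 <= \int[k x]_y (V y)%:E)%E.
  by apply: integral_ge0 => y _; rewrite lee_fin ltW ?weight_gt0.
have s0 : (0 <= s)%E.
  apply: le_trans (le point); rewrite mule_ge0// lee_fin invr_ge0 ltW//.
  exact: weight_gt0.
have sE : s \is a fin_num by rewrite ge0_fin_numE.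
exists (fine s + 1); first by rewrite ltr_wpDl// fine_ge0.
move=> x; rewrite EFinM -lee_pdivrMr ?weight_gt0//.
by rewrite (le_trans (le x))// EFinD fineK// leeDl.
Qed.

Lemma integrable_V x : (k x).-integrable [set: E] (fun y => (V y)%:E).
Proof.
have [M M0 kM] := kernel_bound.
apply/integrableP; split.
  by apply/measurable_EFinP; exact: measurable_weight.
under eq_integral do rewrite gee0_abs ?lee_fin ?(ltW (weight_gt0 _ _))//.
by rewrite (le_lt_trans (kM x))// ltry.
Qed.

Lemma integrable_Linfty (g : E -> R) C x : measurable_fun [set: E] g ->
  (forall y, `|g y| <= C * V y) -> (k x).-integrable [set: E] (EFin \o g).
Proof.
move=> mg gC; apply: (@le_integrable _ _ _ _ _ _ _ (fun y => (C * V y)%:E)) => //.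
- exact/measurable_EFinP.
- by move=> y _ /=; rewrite lee_fin (le_trans (gC y))// ler_norm.
- under eq_fun do rewrite EFinM.
  by apply: integrableZl => //; exact: integrable_V.
Qed.

Lemma Linfty_Re (f : Linfty V) x :
  (k x).-integrable [set: E] (EFin \o (fun y => complex.Re (f y))).
Proof.
have /asboolP[/cmeasurableP[mR mI] _] := Linfty_funP f.
apply: (integrable_Linfty (C := Vnorm f)) => // y.
exact: le_trans (normc_ge_absRe _) (le_Vnorm _ _).
Qed.

Lemma Linfty_Im (f : Linfty V) x :
  (k x).-integrable [set: E] (EFin \o (fun y => complex.Im (f y))).
Proof.
have /asboolP[/cmeasurableP[mR mI] _] := Linfty_funP f.
apply: (integrable_Linfty (C := Vnorm f)) => // y.
exact: le_trans (normc_ge_absIm _) (le_Vnorm _ _).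
Qed.

Lemma measurable_kRint (g : E -> R) : measurable_fun [set: E] g ->
  measurable_fun [set: E] (fun x => \int[k x]_y g y).
Proof.
move=> mg; have mEg : measurable_fun [set: E] (EFin \o g) by exact/measurable_EFinP.
apply: measurableT_comp => //.
under eq_fun do rewrite integralE.
apply: emeasurable_funB.
- apply: measurable_fun_integral_kernel => //; last exact: measurable_funepos.
  exact: measurable_kernel.
- apply: measurable_fun_integral_kernel => //; last exact: measurable_funeneg.
  exact: measurable_kernel.
Qed.

Lemma kRint_bound (g : E -> R) C M x : measurable_fun [set: E] g -> 0 <= C ->
  (forall y, `|g y| <= C * V y) -> (\int[k x]_y (V y)%:E <= (M * V x)%:E)%E ->
  `|\int[k x]_y g y| <= C * M * V x.
Proof.
move=> mg C0 gC kM.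
apply: (le_trans (le_normr_Rintegral _ _)) => //.
  exact: (integrable_Linfty (C := C)).
have CV : \int[k x]_y (C * V y) = C * \int[k x]_y V y.
  by apply: RintegralZl => //; exact: integrable_V.
rewrite (@le_trans _ _ (\int[k x]_y (C * V y)))//.
  apply: le_Rintegral => //.
  - apply: (integrable_Linfty (C := C)) => [|y]; last by rewrite normr_id.
    exact: measurableT_comp.
  - by apply: (@integrableZl _ _ _ _ _ _ _ (fun y => (V y)%:E)) => //; exact: integrable_V.
rewrite CV -mulrA ler_wpM2l// -lee_fin fineK//.
exact: integrable_fin_num (integrable_V x).
Qed.

Lemma kint_Linfty (f : Linfty V) : kint k f \in Linfty_pred V.
Proof.
have /asboolP[/cmeasurableP[mR mI] _] := Linfty_funP f.
have [M M0 kM] := kernel_bound.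
apply/asboolP; split.
  by apply/cmeasurableP; split; exact: measurable_kRint.
have nf := Vnorm_ge0 f.
exists (Vnorm f * M + Vnorm f * M + 1).
  by rewrite ltr_wpDl// addr_ge0// mulr_ge0// ltW.
move=> x; rewrite (le_trans (normc_le_absD _))//= !mulrDl ler_wpDr//.
  by rewrite mul1r ltW ?weight_gt0.
rewrite lerD//; apply: kRint_bound => // y.
- exact: le_trans (normc_ge_absRe _) (le_Vnorm _ _).
- exact: le_trans (normc_ge_absIm _) (le_Vnorm _ _).
Qed.

Lemma kRint_comb (u v w : E -> R) (a b : R) x :
  (k x).-integrable [set: E] (EFin \o u) ->
  (k x).-integrable [set: E] (EFin \o v) ->
  (k x).-integrable [set: E] (EFin \o w) ->
  \int[k x]_y (a * u y + b * v y + w y) =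
  a * \int[k x]_y u y + b * \int[k x]_y v y + \int[k x]_y w y.
Proof.
move=> iu iv iw.
have iZ c h : (k x).-integrable [set: E] (EFin \o h) ->
    (k x).-integrable [set: E] (EFin \o (fun y => c * h y)).
  by move=> ih; apply: (@integrableZl _ _ _ _ _ _ _ (EFin \o h)).
rewrite !RintegralD ?RintegralZl//; [exact: iZ|exact: iZ|].
apply: (@integrableD _ _ _ _ _ _ (EFin \o (fun y => a * u y))
  (EFin \o (fun y => b * v y))) => //; exact: iZ.
Qed.

Definition kop (f : Linfty V) : Linfty V := MkLinfty (kint_Linfty f).

Lemma kop_is_linear : linear kop.
Proof.
move=> a f g; apply: val_inj; apply/funext => x /=.
rewrite /kint /= !fctE /GRing.scale/=.
have fR := Linfty_Re f x; have fI := Linfty_Im f x.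
have gR := Linfty_Re g x; have gI := Linfty_Im g x.
case: a => a1 a2.
have -> : \int[k x]_y complex.Re ((a1 +i* a2) * f y + g y) =
    a1 * \int[k x]_y complex.Re (f y) + (- a2) * \int[k x]_y complex.Im (f y) +
    \int[k x]_y complex.Re (g y).
  rewrite -kRint_comb//; apply: eq_Rintegral => y _.
  by case: (f y) (g y) => ? ? [? ?] /=; rewrite mulNr.
have -> : \int[k x]_y complex.Im ((a1 +i* a2) * f y + g y) =
    a1 * \int[k x]_y complex.Im (f y) + a2 * \int[k x]_y complex.Re (f y) +
    \int[k x]_y complex.Im (g y).
  rewrite -kRint_comb//; apply: eq_Rintegral => y _.
  by case: (f y) (g y) => ? ? [? ?] /=.
by rewrite mulNr.
Qed.

HB.instance Definition _ :=
  GRing.isLinear.Build R[i] (Linfty V) (Linfty V) _ kop kop_is_linear.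

End kernel_operator.

Section essential_spectral_radius.
Context (R : realType) (B : normedModType R[i]).

(* `|T f| is a real element of R[i]; complex.Re reads it in R. The sup is the
   operator norm when T is bounded, and is 0 when T is linear and unbounded. *)
Definition opnorm (T : B -> B) : R :=
  sup [set complex.Re `|T f| | f in [set f : B | `|f| <= 1]].

Definition compact_operator (K : {linear B -> B}) : Prop :=
  precompact [set K f | f in [set f : B | `|f| <= 1]].

(* The term n = 0 (exponent 0^-1 = 0) is irrelevant to the limit. *)
Definition ess_spectral_radius (T : {linear B -> B}) : R :=
  limn (fun n => inf [set opnorm (fun f => iter n T f - K f) `^ n%:R^-1
                     | K in compact_operator]).

End essential_spectral_radius.

(* Main.v *)
(* Say that a kernel N vanishes uniformly below b when, along every sequence of
   measurable sets A_n decreasing to the empty set, sup_x N(x, A_n) <= b for some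
   n. Conjugation by V turns P and Q into finite kernels acting on bounded
   functions, and this property passes from the powers of Q to those of P. It is
   tied to compact operators in both directions, up to constants which disappear
   after taking roots of the norms of large powers.

   If K is compact then N vanishes uniformly below any b > 2 ||N - K||: N 1_{A_n}
   tends to 0 pointwise, so that a cluster point of (K 1_{A_n}) has norm at most
   ||N - K||.

   Conversely, if N vanishes uniformly below b then N(x, .) <= M mu + b for some
   finite measure mu, which may be taken with mu N <= K mu. Let A_i be the
   conditional expectation for mu over the finite partition defined by the first i
   generators of the sigma-algebra, D_i = 1 - A_i. By the Hahn and Radon-Nikodym
   theorems, N D_i sends the unit ball into functions bounded by 2b up to an error
   which tends to 0 in L^1(mu); by iteration, ||(N D_i)^l|| <= L (4b)^l for i large,
   with L independent of l. As A_i has finite rank, N^l - (N D_i)^l is compact. *)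

Require Import Defs.
From HB Require Import structures.
From mathcomp Require Import all_boot all_order all_algebra finmap.
From mathcomp Require Import all_classical all_reals all_analysis.
From mathcomp Require Import measurable_realfun complex.
From mathcomp Require Import ring lra.

Set Implicit Arguments.
Unset Strict Implicit.
Unset Printing Implicit Defensive.
Import Order.TTheory GRing.Theory Num.Theory.
Import numFieldNormedType.Exports.

Local Open Scope classical_set_scope.
Local Open Scope ring_scope.

(** * Submultiplicative sequences *)

Section fekete.
Context {R : realType}.
Implicit Types (D : nat -> R).

(** A kernel dominated by a rank one kernel need not be compact, so compact approximants of powers
    of [Q] give none for [P] directly. Uniform vanishing only compares values on sets, hence is
    monotone, but it measures the distance to the compact operators up to a factor; this is why all
    powers of [Q] are used and not [Q] alone.

    The domination of [N(x, .)] yields a density with respect to [mu] for each [x], and averages are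
    good against that density only from an index depending on [x]. This is why the error of [N D_i]
    is small in [L^1(mu)] and not in sup norm. The iteration then follows the [L^1(mu)] mass of the
    part above [(2b)^l], for which [N] must be bounded on [L^1(mu)] (the reason for [mu N <= K mu]),
    and recovers the sup norm by one more application of [N]. The 2 in [2b] bounds the norm of
    [D_i]; the further 2 in [4b] comes from adding an [L^1(mu)] and a sup contribution. The index
    [i] may depend on [l], because the compact operator subtracted from [N^l] may. *)

Definition submultiplicative D := forall m n, D (m + n)%N <= D m * D n.

Lemma submultiplicativeM D m k : (forall n, 0 <= D n) -> submultiplicative D ->
  D (m * k.+1)%N <= D m ^+ k.+1.
Proof.
move=> D0 Ds; elim: k => [|k IH]; first by rewrite muln1 expr1.
rewrite mulnS exprS (le_trans (Ds _ _))//.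
by rewrite ler_wpM2l.
Qed.

Lemma root_le (x y : R) n : (0 < n)%N -> 0 <= x -> 0 <= y ->
  x <= y ^+ n -> x `^ n%:R^-1 <= y.
Proof.
move=> n0 x0 y0 xy.
have nn : (n%:R : R) != 0 by rewrite pnatr_eq0 -lt0n.
have yE : y = (y ^+ n) `^ n%:R^-1.
  by rewrite -powR_mulrn// -powRrM divff// powRr1.
by rewrite yE; apply: ge0_ler_powR; rewrite ?invr_ge0 ?nnegrE ?exprn_ge0.
Qed.

Lemma root_expr (x : R) n : (0 < n)%N -> 0 <= x -> (x `^ n%:R^-1) ^+ n = x.
Proof.
move=> n0 x0; have nn : (n%:R : R) != 0 by rewrite pnatr_eq0 -lt0n.
by rewrite -powR_mulrn ?powR_ge0// -powRrM mulVf// powRr1.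
Qed.

Lemma cvg_root (C : R) : 0 < C -> (fun n => C `^ n%:R^-1) @ \oo --> (1 : R).
Proof.
move=> C0.
have -> : (fun n => C `^ n%:R^-1) = (fun n => expR (n%:R^-1 * ln C)).
  by apply/funext => n; rewrite /powR gt_eqF.
rewrite -[X in _ --> X]expR0; apply: continuous_cvg; first exact: continuous_expR.
have h : (fun n => n%:R^-1 : R) @ \oo --> (0 : R).
  by have <- := @cvg_shiftS R (fun n => n%:R^-1) (nbhs (0 : R)); exact: cvg_harmonic.
by rewrite -[X in _ --> X](mul0r (ln C)); apply: cvgM => //; exact: cvg_cst.
Qed.

(** The two hypotheses on [l] make it the infimum of the roots over positive [n]. Dividing [n] by a
    good [m] with remainder bounds [D n] by [C * q ^+ n], with [q] slightly above [l] and [C]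
    independent of [n], and the n-th root of [C] tends to 1. *)
Lemma fekete D l : (forall n, 0 <= D n) -> submultiplicative D ->
  (forall n, (0 < n)%N -> l <= D n `^ n%:R^-1) ->
  (forall e, 0 < e -> exists2 m, (0 < m)%N & D m `^ m%:R^-1 < l + e) ->
  (fun n => D n `^ n%:R^-1) @ \oo --> l.
Proof.
move=> D0 Ds lD Dl.
apply/cvgrPdist_lt => e e0.
have [|m m0 Dm] := Dl (e / 2); first by rewrite divr_gt0.
set q := l + e / 2 in Dm *.
have q0 : 0 < q by rewrite (le_lt_trans _ Dm)// powR_ge0.
have Dmq k : D (m * k.+1)%N <= q ^+ (m * k.+1).
  rewrite (le_trans (submultiplicativeM _ _ _ _))// exprM lerXn2r ?nnegrE ?exprn_ge0 ?(ltW q0)//.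
  by rewrite -(root_expr m0 (D0 m)) lerXn2r ?nnegrE ?powR_ge0 ?(ltW q0) ?(ltW Dm).
(* The sum over all remainders [i < m] stands for a maximum; the 1 keeps [C] positive even if every
   [D i] vanishes. *)
pose C := 1 + \sum_(i < m) D i / q ^+ i.
have C1 : 1 <= C by rewrite lerDl sumr_ge0// => i _; rewrite divr_ge0// exprn_ge0// ltW.
have C0 : 0 < C by rewrite (lt_le_trans _ C1).
(* [m <= n] makes the quotient positive: a zero quotient would bring in [D 0], which may exceed
   1. *)
have DC n : (m <= n)%N -> D n <= C * q ^+ n.
  move=> mn; rewrite {1}(divn_eq n m).
  have k1 : (0 < n %/ m)%N by rewrite divn_gt0.
  have := Dmq (n %/ m).-1; rewrite prednK// => h.
  have rm : (n %% m < m)%N by rewrite ltn_mod.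
  have h2 : D (n %% m)%N <= C * q ^+ (n %% m).
    rewrite -ler_pdivrMr ?exprn_gt0// /C (bigD1 (Ordinal rm))//=.
    rewrite addrCA lerDl addr_ge0// sumr_ge0// => i _.
    by rewrite divr_ge0// exprn_ge0// ltW.
  rewrite (le_trans (Ds _ _))// [in leRHS](divn_eq n m) exprD mulrCA.
  by rewrite ler_pM// mulnC.
have /cvgrPdist_lt /(_ (e / 2 / q)) := cvg_root C0.
rewrite !divr_gt0// => /(_ isT) hC.
near=> n.
have n0 : (0 < n)%N by near: n; exists 1.
have lDn := lD n n0.
rewrite ler0_norm ?subr_le0// opprB.
have h1 : D n `^ n%:R^-1 <= C `^ n%:R^-1 * q.
  apply: root_le => //; first by rewrite mulr_ge0 ?powR_ge0 ?ltW.
  rewrite exprMn root_expr ?(ltW C0)//; apply: DC.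
  by near: n; exists m.
have h2 : C `^ n%:R^-1 < 1 + e / 2 / q.
  have : `|1 - C `^ n%:R^-1| < e / 2 / q by near: n.
  by rewrite ltr_norml => /andP[+ _]; lra.
have h3 : C `^ n%:R^-1 * q < (1 + e / 2 / q) * q by rewrite ltr_pM2r.
have h4 : (1 + e / 2 / q) * q = q + e / 2 by field; rewrite gt_eqF.
rewrite ltrBlDl; rewrite h4 /q in h3; rewrite (le_lt_trans h1)//.
by rewrite (lt_le_trans h3)// -/q /q; lra.
Unshelve. all: by end_near.
Qed.

(** If [x / y = 1 + h] with [h > 0], its powers outgrow [C] since [k%:R * h <= (1 + h) ^+ k]. This
    is what discards a factor independent of [k]. *)
Lemma exp_le_cst (x y C : R) : 0 <= x -> 0 < y ->
  (forall k, x ^+ k <= C * y ^+ k) -> x <= y.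
Proof.
move=> x0 y0 xy; rewrite leNgt; apply/negP => yx.
pose h := x / y - 1.
have h0 : 0 < h by rewrite subr_gt0 ltr_pdivlMr// mul1r.
have hk k : k%:R * h <= C.
  have : (x / y) ^+ k <= C by rewrite expr_div_n ler_pdivrMr ?exprn_gt0.
  apply: le_trans; have -> : x / y = 1 + h by rewrite /h addrC subrK.
  elim: k => [|k IH]; first by rewrite mul0r expr0.
  rewrite exprS -natr1.
  have p : 1 <= (1 + h) ^+ k by rewrite exprn_ege1// lerDl ltW.
  by have := ler_peMr (ltW h0) p; lra.
have [k] : exists k : nat, C / h < k%:R.
  by exists (Num.truncn (C / h)).+1; rewrite truncnS_gt.
by rewrite ltr_pdivrMr// ltNge hk.
Qed.

End fekete.

(** * Compact operators and the essential spectral radius *)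

Section real_norm.
Context {R : realType} {B : normedModType R[i]}.
Implicit Types (f g : B).

Definition nrm f : R := complex.Re `|f|.

Lemma nrmE f : `|f| = (nrm f)%:C%C.
Proof. by rewrite RRe_real// normr_real. Qed.

Lemma nrm_ge0 f : 0 <= nrm f.
Proof. by rewrite -lecR -nrmE normr_ge0. Qed.

Lemma ler_nrmD f g : nrm (f + g) <= nrm f + nrm g.
Proof. by rewrite -lecR rmorphD/= -!nrmE ler_normD. Qed.

Lemma nrmN f : nrm (- f) = nrm f.
Proof. by rewrite /nrm normrN. Qed.

Lemma ler_nrmB f g : nrm (f - g) <= nrm f + nrm g.
Proof. by rewrite (le_trans (ler_nrmD _ _))// nrmN. Qed.

Lemma nrm0 : nrm (0 : B) = 0.
Proof. by rewrite /nrm normr0. Qed.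

Lemma nrmZ (a : R) f : 0 <= a -> nrm (a%:C%C *: f) = a * nrm f.
Proof.
move=> a0; apply: complexI; rewrite -nrmE normrZ nrmE rmorphM/=.
by rewrite ger0_norm// -[0]/(0%:C%C) lecR.
Qed.

Lemma nrm_eq0 f : nrm f = 0 -> f = 0.
Proof. by move=> f0; apply: normr0_eq0; rewrite nrmE f0. Qed.

Definition nball (r : R) := [set f : B | nrm f <= r].

Lemma nball1E : [set f : B | `|f| <= 1] = nball 1.
Proof. by apply/seteqP; split => f; rewrite /nball/= nrmE -[1 : R[i]]/(1%:C%C) lecR. Qed.

Lemma nrm_continuous : continuous (nrm : B -> R).
Proof.
move=> f; apply/cvgrPdist_lt => e e0.
have e0' : 0 < e%:C%C :> R[i] by rewrite -[0]/(0%:C%C) ltcR.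
apply/nbhs_ballP; exists e%:C%C => //= g; rewrite -ball_normE /= nrmE ltcR.
apply: le_lt_trans.
have h1 := ler_nrmD (f - g) g; have h2 := ler_nrmD (g - f) f.
rewrite subrK in h1; rewrite subrK -(nrmN (g - f)) opprB in h2.
by rewrite ler_norml; apply/andP; split; lra.
Qed.

Definition bounded_by (T : B -> B) (M : R) := forall f, nrm (T f) <= M * nrm f.

Lemma bounded_by_continuous (T : {linear B -> B}) M :
  0 <= M -> bounded_by T M -> continuous T.
Proof.
move=> M0 TM f; apply/cvgrPdist_lt => e e0.
have eE : e = (complex.Re e)%:C%C by rewrite RRe_real// gtr0_real.
set r := complex.Re e in eE; have r0 : 0 < r by rewrite -ltcR -eE.
have d0 : 0 < (r / (M + 1))%:C%C :> R[i].
  by rewrite -[0]/(0%:C%C) ltcR divr_gt0// ltr_wpDl.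
apply/nbhs_ballP; exists (r / (M + 1))%:C%C => //= g.
rewrite -ball_normE /= -raddfB !nrmE eE !ltcR => fg.
rewrite (le_lt_trans (TM _))// (@le_lt_trans _ _ ((M + 1) * nrm (f - g)))//.
  by rewrite ler_wpM2r ?nrm_ge0// lerDl.
by rewrite mulrC -ltr_pdivlMr// ltr_wpDl.
Qed.

Lemma opnorm_has_sup (T : B -> B) M : 0 <= M -> bounded_by T M ->
  has_sup [set complex.Re `|T f| | f in [set f : B | `|f| <= 1]].
Proof.
move=> M0 TM; rewrite nball1E; split.
  by exists (nrm (T 0)), 0 => //; rewrite /nball/= nrm0.
exists M => _ [f f1 <-]; rewrite (le_trans (TM f))//.
by rewrite ler_piMr.
Qed.

(** True for every map, since [sup] is 0 on a set without supremum. *)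
Lemma opnorm_ge0 (T : B -> B) : 0 <= opnorm T.
Proof.
rewrite /opnorm; set S := (X in sup X).
have [hS|nS] := pselect (has_sup S); last by rewrite sup_out.
have [x Sx] := hS.1.
rewrite (le_trans _ (sup_upper_bound hS Sx))//.
by case: Sx => f _ <-; exact: nrm_ge0.
Qed.

Lemma opnorm_le (T : B -> B) M : 0 <= M -> bounded_by T M -> opnorm T <= M.
Proof.
move=> M0 TM; apply: ge_sup; first by have [] := opnorm_has_sup M0 TM.
rewrite nball1E => _ [f f1 <-]; rewrite (le_trans (TM f))//.
by rewrite ler_piMr.
Qed.

(** Some bound [M] has to be known beforehand: for an unbounded linear map [opnorm] is 0. *)
Lemma le_opnorm (T : {linear B -> B}) M : 0 <= M -> bounded_by T M ->
  bounded_by T (opnorm T).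
Proof.
move=> M0 TM f; have [f0|f0] := eqVneq (nrm f) 0.
  by rewrite (nrm_eq0 f0) raddf0 nrm0 mulr0.
have fp : 0 < nrm f by rewrite lt_neqAle eq_sym f0 nrm_ge0.
have fE : f = (nrm f)%:C%C *: ((nrm f)^-1%:C%C *: f).
  by rewrite scalerA -rmorphM/= divff// scale1r.
rewrite {1}fE linearZ/= nrmZ ?nrm_ge0// mulrC ler_wpM2r ?nrm_ge0//.
apply: sup_upper_bound; first exact: opnorm_has_sup TM.
rewrite nball1E; exists ((nrm f)^-1%:C%C *: f) => //.
by rewrite /nball/= nrmZ ?invr_ge0 ?nrm_ge0// mulVf.
Qed.

End real_norm.

Section compact_operators.
Context {R : realType} {B : normedModType R[i]}.
Implicit Types (K T : {linear B -> B}).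

(** Any compact set containing the image of the unit ball will do, which turns sums and compositions
    into continuous images of compact sets. *)
Lemma compact_operatorP K :
  compact_operator K <-> exists2 C, compact C & forall f, nrm f <= 1 -> C (K f).
Proof.
rewrite /compact_operator nball1E precompactE; split=> [cK|[C cC KC]].
  eexists; first exact: cK.
  by move=> f f1; apply: subset_closure; exists f.
rewrite -precompactE; apply: (@precompact_subset _ _ C).
  by move=> _ [f f1 <-]; exact: KC.
by apply: compact_precompact => //; exact: norm_hausdorff.
Qed.

Lemma compact_operator_bounded K : compact_operator K ->
  exists2 M, 0 <= M & bounded_by K M.
Proof.
move=> /compact_operatorP[C cC KC].
have cN : compact [set nrm f | f in C].
  by apply: continuous_compact cC; apply: continuous_subspaceT; exact: nrm_continuous.
have [M [_ CM]] := compact_bounded cN.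
have M1 : forall f, nrm f <= 1 -> nrm (K f) <= `|M| + 1.
  move=> f /KC Cf; rewrite -[nrm _]ger0_norm ?nrm_ge0//; apply: CM.
    by rewrite (le_lt_trans (ler_norm _))// ltrDl.
  by exists (K f).
exists (`|M| + 1) => [|f]; first by rewrite addr_ge0.
have [f0|f0] := eqVneq (nrm f) 0.
  by rewrite (nrm_eq0 f0) raddf0 nrm0 mulr0.
have fp : 0 < nrm f by rewrite lt_neqAle eq_sym f0 nrm_ge0.
have fE : f = (nrm f)%:C%C *: ((nrm f)^-1%:C%C *: f).
  by rewrite scalerA -rmorphM/= divff// scale1r.
rewrite {1}fE linearZ/= nrmZ ?nrm_ge0// mulrC ler_wpM2r ?nrm_ge0//.
by apply: M1; rewrite nrmZ ?invr_ge0 ?nrm_ge0// mulVf.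
Qed.

Lemma eq_compact_operator K T : K =1 T -> compact_operator K -> compact_operator T.
Proof.
move=> KT /compact_operatorP[C cC KC]; apply/compact_operatorP.
by exists C => // f f1; rewrite -KT; exact: KC.
Qed.

Lemma compact_operator0 : compact_operator (\0 : {linear B -> B}).
Proof.
apply/compact_operatorP; exists [set 0]; first exact: compact_set1.
by move=> f _ /=.
Qed.

Lemma compact_operatorD K1 K2 : compact_operator K1 -> compact_operator K2 ->
  compact_operator (K1 \+ K2 : {linear B -> B}).
Proof.
move=> /compact_operatorP[C1 cC1 KC1] /compact_operatorP[C2 cC2 KC2].
apply/compact_operatorP; exists [set f.1 + f.2 | f in C1 `*` C2].
  apply: continuous_compact; last exact: compact_setX.
  by apply: continuous_subspaceT; exact: add_continuous.
by move=> f f1; exists (K1 f, K2 f) => //; split=> /=; [exact: KC1|exact: KC2].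
Qed.

Lemma compact_operator_compl T K M : 0 <= M -> bounded_by T M ->
  compact_operator K -> compact_operator (T \o K : {linear B -> B}).
Proof.
move=> M0 TM /compact_operatorP[C cC KC].
apply/compact_operatorP; exists (T @` C).
  apply: continuous_compact cC; apply: continuous_subspaceT.
  exact: bounded_by_continuous TM.
by move=> f f1; exists (K f) => //; exact: KC.
Qed.

Lemma compact_operator_compr T K M : 0 <= M -> bounded_by T M ->
  compact_operator K -> compact_operator (K \o T : {linear B -> B}).
Proof.
move=> M0 TM /compact_operatorP[C cC KC].
(* [T] maps the unit ball into the ball of radius [M + 1], and this factor, unlike [M], is always
   invertible. *)
have M1 : 0 < M + 1 by rewrite ltr_wpDl.
apply/compact_operatorP; exists (( *:%R (M + 1)%:C%C) @` C).
  apply: continuous_compact cC; apply: continuous_subspaceT.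
  exact: scaler_continuous.
move=> f f1; exists (K ((M + 1)^-1%:C%C *: T f)); last first.
  by rewrite linearZ/= scalerA -rmorphM/= divff ?gt_eqF// scale1r.
apply: KC; rewrite nrmZ ?invr_ge0 ?(ltW M1)// mulrC ler_pdivrMr// mul1r.
rewrite (le_trans (TM _))// (@le_trans _ _ M)// ?lerDl//.
by rewrite ler_piMr.
Qed.

End compact_operators.

Section essential_radius.
Context {R : realType} {B : normedModType R[i]}.
Implicit Types (K T : {linear B -> B}).

Fixpoint iter_lin T n : {linear B -> B} :=
  if n is n'.+1 then (T \o iter_lin T n' : {linear B -> B}) else (idfun : {linear B -> B}).

Lemma iter_linE T n f : iter_lin T n f = iter n T f.
Proof. by elim: n => //= n <-. Qed.

Lemma iter_bounded_by (T : B -> B) M n : 0 <= M -> bounded_by T M ->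
  bounded_by (iter n T) (M ^+ n).
Proof.
move=> M0 TM f; elim: n => [|n IH] /=; first by rewrite expr0 mul1r.
by rewrite (le_trans (TM _))// exprS -mulrA ler_wpM2l.
Qed.

(** For bounded [T], the norm of its class in the Calkin algebra. [T] is a bare function so that
    [iter n T] fits. *)
Definition compact_dist (T : B -> B) : R :=
  inf [set opnorm (fun f => T f - K f) | K in @compact_operator R B].

Lemma compact_dist_has_inf (T : B -> B) :
  has_inf [set opnorm (fun f => T f - K f) | K in @compact_operator R B].
Proof.
split; first by eexists; exists \0; [exact: compact_operator0|reflexivity].
by exists 0 => _ [K _ <-]; exact: opnorm_ge0.
Qed.

Lemma compact_dist_ge0 (T : B -> B) : 0 <= compact_dist T.
Proof.
apply: lb_le_inf; first by have [] := compact_dist_has_inf T.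
by move=> _ [K _ <-]; exact: opnorm_ge0.
Qed.

Lemma compact_dist_le (T : B -> B) K : compact_operator K ->
  compact_dist T <= opnorm (fun f => T f - K f).
Proof. by move=> cK; apply: ge_inf; [case: (compact_dist_has_inf T)|exists K]. Qed.

Lemma compact_dist_adherent (T : B -> B) e : 0 < e ->
  exists2 K, compact_operator K & opnorm (fun f => T f - K f) < compact_dist T + e.
Proof.
by move=> e0; have [_ [K cK <-] h] := inf_adherent e0 (compact_dist_has_inf T); exists K.
Qed.

(** [T1 T2 - K = (T1 - K1) (T2 - K2)] for [K = T1 K2 + K1 (T2 - K2)], which is compact when [K1] and
    [K2] are. *)
Lemma compact_dist_comp T1 T2 M1 M2 : 0 <= M1 -> 0 <= M2 ->
  bounded_by T1 M1 -> bounded_by T2 M2 ->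
  compact_dist (T1 \o T2) <= compact_dist T1 * compact_dist T2.
Proof.
move=> M10 M20 TM1 TM2.
have step K1 K2 : compact_operator K1 -> compact_operator K2 ->
    compact_dist (T1 \o T2) <=
    opnorm (fun f => T1 f - K1 f) * opnorm (fun f => T2 f - K2 f).
  move=> cK1 cK2.
  have [N1 N10 KN1] := compact_operator_bounded cK1.
  have [N2 N20 KN2] := compact_operator_bounded cK2.
  have bB (S K : {linear B -> B}) M N : bounded_by S M -> bounded_by K N ->
      bounded_by (S \- K) (M + N).
    move=> SM KN f /=; rewrite (le_trans (ler_nrmB _ _))// mulrDl.
    by rewrite lerD.
  have b1 : bounded_by (T1 \- K1) (M1 + N1) by exact: bB.
  have b2 : bounded_by (T2 \- K2) (M2 + N2) by exact: bB.
  pose K : {linear B -> B} := (T1 \o K2 : {linear B -> B}) \+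
    (K1 \o (T2 \- K2 : {linear B -> B}) : {linear B -> B}).
  have cK : compact_operator K.
    apply: compact_operatorD; first exact: compact_operator_compl TM1 _.
    exact: (compact_operator_compr (T := T2 \- K2) (addr_ge0 M20 N20) b2).
  rewrite (le_trans (compact_dist_le _ cK))//.
  apply: opnorm_le; first by rewrite mulr_ge0 ?opnorm_ge0.
  move=> f; have -> : (T1 \o T2) f - K f = (T1 \- K1) ((T2 \- K2) f).
    by rewrite /K /= [T1 (T2 f - K2 f)]raddfB/= opprD addrA.
  rewrite (le_trans (le_opnorm (addr_ge0 M10 N10) b1 _))// -mulrA.
  rewrite ler_wpM2l ?opnorm_ge0//.
  exact: (le_opnorm (addr_ge0 M20 N20) b2).
set d1 := compact_dist T1; set d2 := compact_dist T2.
have d10 : 0 <= d1 by exact: compact_dist_ge0.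
have d20 : 0 <= d2 by exact: compact_dist_ge0.
apply/ler_addgt0Pr => e e0.
(* For [0 <= h <= 1], [(d1 + h) * (d2 + h) <= d1 * d2 + h * (d1 + d2 + 1)]. *)
pose h := Num.min 1 (e / (d1 + d2 + 1)).
have h0 : 0 < h by rewrite lt_min ltr01 divr_gt0// ltr_wpDl// addr_ge0.
have h1 : h <= 1 by rewrite ge_min lexx.
have h2 : h * (d1 + d2 + 1) <= e.
  by rewrite -ler_pdivlMr ?ltr_wpDl ?addr_ge0// ge_min lexx orbT.
have [K1 cK1 k1] := compact_dist_adherent T1 h0.
have [K2 cK2 k2] := compact_dist_adherent T2 h0.
rewrite (le_trans (step _ _ cK1 cK2))//.
rewrite (@le_trans _ _ ((d1 + h) * (d2 + h)))//.
  by apply: ler_pM; rewrite ?opnorm_ge0// ltW.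
have : h * h <= h by rewrite ler_piMr// ltW.
by nra.
Qed.

Section fixed_operator.
Variables (T : {linear B -> B}) (M : R).
Hypotheses (M0 : 0 <= M) (TM : bounded_by T M).

Let D n := compact_dist (iter n T).

Lemma compact_dist_iter_submult : submultiplicative D.
Proof.
move=> m n; rewrite /D.
have -> : iter (m + n) T = iter_lin T m \o iter_lin T n.
  by apply/funext => f /=; rewrite !iter_linE iterD.
have -> : iter m T = iter_lin T m by apply/funext => f; rewrite iter_linE.
have -> : iter n T = iter_lin T n by apply/funext => f; rewrite iter_linE.
have h k : bounded_by (iter_lin T k) (M ^+ k).
  by move=> f; rewrite iter_linE; exact: iter_bounded_by.
by apply: (compact_dist_comp (M1 := M ^+ m) (M2 := M ^+ n)); rewrite ?exprn_ge0.
Qed.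

(** The n-th root is an increasing bijection of the nonnegative reals, hence exchanges with the
    infimum. *)
Lemma inf_root n : (0 < n)%N ->
  inf [set opnorm (fun f => iter n T f - K f) `^ n%:R^-1
        | K in @compact_operator R B] = D n `^ n%:R^-1.
Proof.
move=> n0; set S := (X in inf X).
have iS : has_inf S.
  split; first by eexists; exists \0; [exact: compact_operator0|reflexivity].
  by exists 0 => _ [K _ <-]; exact: powR_ge0.
have s0 : 0 <= inf S.
  by apply: lb_le_inf; [case: iS|move=> _ [K _ <-]; exact: powR_ge0].
apply/eqP; rewrite eq_le; apply/andP; split.
  apply/ler_addgt0Pr => e e0; rewrite -lerBlDr.
  have [le0|lt0] := leP (inf S - e) 0; first by rewrite (le_trans le0)// powR_ge0.
  rewrite -(ler_pXn2r n0) ?nnegrE ?powR_ge0 ?(ltW lt0)//.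
  rewrite root_expr ?compact_dist_ge0//.
  apply: lb_le_inf; first by have [] := compact_dist_has_inf (iter n T).
  move=> _ [K cK <-]; rewrite -(root_expr n0 (opnorm_ge0 _)).
  rewrite lerXn2r ?nnegrE ?powR_ge0 ?(ltW lt0)//.
  have h : inf S <= opnorm (fun f => iter n T f - K f) `^ n%:R^-1.
    by apply: ge_inf; [case: iS|exists K].
  by rewrite lerBlDr (le_trans h)// lerDl ltW.
apply: lb_le_inf; first by have [] := iS.
move=> _ [K cK <-]; apply: ge0_ler_powR; rewrite ?invr_ge0 ?nnegrE ?opnorm_ge0 ?compact_dist_ge0//.
exact: compact_dist_le.
Qed.

(** The limit exists, so [limn] in the definition is a true limit and not a default value. The two
    sequences agree from [n = 1] on. *)
Lemma ess_spectral_radius_cvg :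
  (fun n => D n `^ n%:R^-1) @ \oo --> ess_spectral_radius T.
Proof.
pose l := inf [set D n `^ n%:R^-1 | n in [set n | (0 < n)%N]].
have il : has_inf [set D n `^ n%:R^-1 | n in [set n | (0 < n)%N]].
  split; first by eexists; exists 1%N.
  by exists 0 => _ [n _ <-]; exact: powR_ge0.
have cvl : (fun n => D n `^ n%:R^-1) @ \oo --> l.
  apply: fekete; [by move=> n; exact: compact_dist_ge0
    |exact: compact_dist_iter_submult| |].
    by move=> n n0; apply: ge_inf; [case: il|exists n].
  by move=> e e0; have [_ [n n0 <-] h] := inf_adherent e0 il; exists n.
suff -> : ess_spectral_radius T = l by [].
apply: cvg_lim => //; apply: cvg_trans cvl.
by apply: near_eq_cvg; exists 1%N => //= n n0; rewrite inf_root.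
Qed.

(** The limit is read along the multiples of [n], where submultiplicativity bounds every root by
    that of [D n]. *)
Lemma ess_spectral_radius_le n : (0 < n)%N ->
  ess_spectral_radius T ^+ n <= D n.
Proof.
move=> n0.
have h k : D (n * k.+1)%N `^ (n * k.+1)%:R^-1 <= D n `^ n%:R^-1.
  apply: root_le; rewrite ?muln_gt0 ?n0 ?compact_dist_ge0 ?powR_ge0//.
  rewrite exprM root_expr ?compact_dist_ge0//.
  apply: submultiplicativeM; last exact: compact_dist_iter_submult.
  by move=> ?; exact: compact_dist_ge0.
have c : (fun k => D (n * k.+1)%N `^ (n * k.+1)%:R^-1) @ \oo -->
    ess_spectral_radius T.
  apply: (cvg_comp (fun k => n * k.+1)%N _ _ ess_spectral_radius_cvg).
  move=> A [N _ NA]; exists N => // k /= Nk; apply: NA => /=.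
  by rewrite (leq_trans Nk)// (leq_trans (leqnSn _))// leq_pmull.
have le : ess_spectral_radius T <= D n `^ n%:R^-1.
  rewrite -(cvg_lim _ c)//; apply: limr_le; first by apply/cvg_ex; exists (ess_spectral_radius T).
  by near=> k; exact: h.
have ge : 0 <= ess_spectral_radius T.
  rewrite -(cvg_lim _ c)//; apply: limr_ge; first by apply/cvg_ex; exists (ess_spectral_radius T).
  by near=> k; exact: powR_ge0.
by rewrite -[leRHS](root_expr n0 (compact_dist_ge0 _)) lerXn2r// nnegrE powR_ge0.
Unshelve. all: by end_near.
Qed.

Lemma ess_spectral_radius_ge0 : 0 <= ess_spectral_radius T.
Proof.
rewrite -(cvg_lim _ ess_spectral_radius_cvg)//; apply: limr_ge.
  by apply/cvg_ex; exists (ess_spectral_radius T); exact: ess_spectral_radius_cvg.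
by near=> k; exact: powR_ge0.
Unshelve. all: by end_near.
Qed.

End fixed_operator.

(* The constant 8 disappears with the m-th root. *)
Lemma le_ess_spectral_radius T1 T2 M1 M2 : 0 <= M1 -> 0 <= M2 ->
  bounded_by T1 M1 -> bounded_by T2 M2 ->
  (forall m b, (0 < m)%N -> 2 * compact_dist (iter m T2) < b ->
    exists L, forall k, compact_dist (iter (m * k) T1) <= L * (4 * b) ^+ k) ->
  ess_spectral_radius T1 <= ess_spectral_radius T2.
Proof.
move=> M10 M20 TM1 TM2 h.
have r0 := ess_spectral_radius_ge0 M10 TM1.
have le m : (0 < m)%N ->
    ess_spectral_radius T1 <= 8 `^ m%:R^-1 * compact_dist (iter m T2) `^ m%:R^-1.
  move=> m0; rewrite -powRM ?compact_dist_ge0//.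
  rewrite -(ler_pXn2r m0) ?nnegrE ?powR_ge0// root_expr ?mulr_ge0 ?compact_dist_ge0//.
  apply/ler_addgt0Pr => e e0.
  have d0 := compact_dist_ge0 (iter m T2).
  have b0 : 2 * compact_dist (iter m T2) < 2 * compact_dist (iter m T2) + e / 4 by lra.
  have [L hL] := h _ _ m0 b0.
  have -> : 8 * compact_dist (iter m T2) + e = 4 * (2 * compact_dist (iter m T2) + e / 4).
    by field.
  (* [Num.max 1 L] covers [k = 0], where [ess_spectral_radius_le], which asks for a positive
     exponent, does not apply. *)
  apply: (@exp_le_cst _ _ _ (Num.max 1 L)); first exact: exprn_ge0.
    by rewrite mulr_gt0//; lra.
  move=> [|k]; first by rewrite !expr0 mulr1 le_max lexx.
  rewrite -exprM (le_trans (ess_spectral_radius_le M10 TM1 _)) ?muln_gt0 ?m0//.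
  rewrite (le_trans (hL _))// ler_wpM2r ?exprn_ge0 ?le_max ?lexx ?orbT//.
  by rewrite mulr_ge0//; lra.
have c : (fun m => 8 `^ m%:R^-1 * compact_dist (iter m T2) `^ m%:R^-1) @ \oo -->
    1 * ess_spectral_radius T2.
  by apply: cvgM; [exact: cvg_root|exact: ess_spectral_radius_cvg TM2].
rewrite -[leRHS]mul1r -(cvg_lim _ c)//; apply: limr_ge.
  by apply/cvg_ex; eexists; exact: c.
by near=> m; apply: le; near: m; exists 1%N.
Unshelve. all: by end_near.
Qed.

End essential_radius.

(** * Domination of finite measures *)

Section bounded_measurable.
Context d (E : measurableType d) (R : realType).
Implicit Types (u v : E -> R) (C : R).

Definition bmeas u := measurable_fun [set: E] u /\ exists C, forall x, `|u x| <= C.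

Lemma bmeasD u v : bmeas u -> bmeas v -> bmeas (fun x => u x + v x).
Proof.
move=> [mu [C uC]] [mv [D vD]]; split; first exact: measurable_funD.
by exists (C + D) => x; rewrite (le_trans (ler_normD _ _))// lerD.
Qed.

Lemma bmeasZ a u : bmeas u -> bmeas (fun x => a * u x).
Proof.
move=> [mu [C uC]]; split; first exact: measurable_funM.
by exists (`|a| * C) => x; rewrite normrM ler_wpM2l.
Qed.

Lemma bmeasN u : bmeas u -> bmeas (fun x => - u x).
Proof.
move=> [mu [C uC]]; split; first exact: measurableT_comp.
by exists C => x; rewrite normrN.
Qed.

Lemma bmeasB u v : bmeas u -> bmeas v -> bmeas (fun x => u x - v x).
Proof. by move=> bu bv; apply: bmeasD => //; exact: bmeasN. Qed.

Lemma bmeas_norm u : bmeas u -> bmeas (fun x => `|u x|).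
Proof.
move=> [mu [C uC]]; split; first exact: measurableT_comp.
by exists C => x; rewrite normr_id.
Qed.

Lemma bmeas_cst C : bmeas (fun=> C).
Proof. by split; [exact: measurable_cst|exists `|C|]. Qed.

Lemma bmeas_indic (A : set E) : measurable A -> bmeas (\1_A).
Proof.
move=> mA; split; first exact: measurable_indic.
by exists 1 => x; rewrite indicE ger0_norm ?ler0n// lern1 leq_b1.
Qed.

Lemma bmeas_integrable (mu : {measure set E -> \bar R}) u :
  (mu [set: E] < +oo)%E -> bmeas u -> mu.-integrable [set: E] (EFin \o u).
Proof.
move=> muT [mu_ [C uC]]; apply: measurable_bounded_integrable => //.
exists C; split; first exact: num_real.
by move=> M CM x _ /=; rewrite (le_trans (uC x))// ltW.
Qed.

Lemma Rintegral_norm_le (mu : {measure set E -> \bar R}) u C :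
  (mu [set: E] < +oo)%E -> bmeas u -> (forall x, `|u x| <= C) ->
  \int[mu]_x `|u x| <= C * fine (mu [set: E]).
Proof.
move=> muT bu uC; rewrite -Rintegral_cst//; apply: le_Rintegral => //.
- by apply: bmeas_integrable => //; exact: bmeas_norm.
- by apply: bmeas_integrable => //; exact: bmeas_cst.
Qed.

Lemma le_norm_Rintegral (mu : {measure set E -> \bar R}) u :
  (mu [set: E] < +oo)%E -> bmeas u ->
  `|\int[mu]_x u x| <= \int[mu]_x `|u x|.
Proof. by move=> muT bu; apply: le_normr_Rintegral => //; exact: bmeas_integrable. Qed.

Lemma norm_Rintegral_le (mu : {measure set E -> \bar R}) u C :
  (mu [set: E] < +oo)%E -> bmeas u -> (forall x, `|u x| <= C) ->
  `|\int[mu]_x u x| <= C * fine (mu [set: E]).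
Proof.
move=> muT bu uC; rewrite (le_trans (le_norm_Rintegral _ _))//.
exact: Rintegral_norm_le.
Qed.

Lemma bmeas_integralE (mu : {measure set E -> \bar R}) u :
  (mu [set: E] < +oo)%E -> bmeas u -> (\int[mu]_x (u x)%:E)%E = (\int[mu]_x u x)%:E.
Proof.
by move=> muT bu; rewrite fineK//; apply: integrable_fin_num => //; exact: bmeas_integrable.
Qed.

(** Every bounded [u] is [(u + C) - C], a difference of nonnegative bounded functions. Identities
    can thus be proved with integrals in [\bar R] of nonnegative functions. *)
Lemma bmeas_ind (F G : (E -> R) -> R) :
  (forall u v, bmeas u -> bmeas v -> F (fun x => u x - v x) = F u - F v) ->
  (forall u v, bmeas u -> bmeas v -> G (fun x => u x - v x) = G u - G v) ->
  (forall u, bmeas u -> (forall x, 0 <= u x) -> F u = G u) ->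
  forall u, bmeas u -> F u = G u.
Proof.
move=> FB GB FG u bu; have [_ [C uC]] := bu.
have bC := bmeas_cst C.
have bD := bmeasD bu bC.
have -> : u = fun x => (u x + C) - C by apply/funext => x; rewrite addrK.
rewrite FB// GB// !FG//.
  by move=> x; rewrite (le_trans _ (uC x)).
by move=> x; have := uC x; rewrite ler_norml => /andP[+ _]; rewrite -subr_ge0 opprK.
Qed.

End bounded_measurable.

Section domination.
Context d (E : measurableType d) (R : realType).
Variables (nu mu : {finite_measure set E -> \bar R}) (M b : R).
Hypotheses (M0 : 0 <= M)
  (numu : forall A, measurable A -> (nu A <= M%:E * mu A + b%:E)%E).

Let sigma : {charge set E -> \bar R} :=
  cadd (charge_of_finite_measure nu) (cscale (- M) (charge_of_finite_measure mu)).

(* The Jordan decomposition of [nu - M mu], written without subtraction. *)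
Lemma jordan_split : exists rho kappa : {finite_measure set E -> \bar R},
  [/\ (rho [set: E] <= b%:E)%E,
      forall A, measurable A -> (nu A + kappa A = rho A + M%:E * mu A)%E &
      forall A, measurable A -> (kappa A <= M%:E * mu A)%E].
Proof.
have [P [N PN]] := Hahn_decomposition sigma.
have [[mP Ppos] [mN Nneg] _ _] := PN.
have sE A : measurable A -> sigma A = (nu A - M%:E * mu A)%E.
  by move=> mA; rewrite -mulNe -EFinN.
have fnu A : measurable A -> nu A \is a fin_num by move=> mA; exact: fin_num_measure.
have fmu A : measurable A -> (M%:E * mu A)%E \is a fin_num.
  by move=> mA; rewrite fin_numM// fin_num_measure.
exists (jordan_pos PN), (jordan_neg PN).
have posE A : measurable A -> jordan_pos PN A = sigma (A `&` P).
  by move=> mA; rewrite jordan_posE cjordan_posE /crestr0 mem_set.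
have negE A : measurable A -> jordan_neg PN A = (- sigma (A `&` N))%E.
  by move=> mA; rewrite jordan_negE cjordan_negE /crestr0 mem_set.
split.
(* The total mass of [rho] is [sigma P = nu P - M mu P]: the hypothesis on the single set [P] bounds
   it by [b]. *)
- rewrite [leLHS]posE// setTI sE//.
  by rewrite leeBlDr ?fmu// addeC; exact: numu.
- move=> A mA; have := jordan_decomp PN mA.
  rewrite sE// /cadd/= cscaleN1/=.
  have f1 : jordan_pos PN A \is a fin_num by exact: fin_num_measure.
  have f2 : jordan_neg PN A \is a fin_num by exact: fin_num_measure.
  rewrite -(fineK f1) -(fineK f2) -(fineK (fnu _ mA)) -(fineK (fmu _ mA)).
  by rewrite -!EFinN -!EFinD => -[h]; congr (_%:E); lra.
- move=> A mA; rewrite [leLHS]negE// sE; last exact: measurableI.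
  have fI : measurable (A `&` N) by exact: measurableI.
  rewrite fin_num_oppeB ?fnu ?fmu//.
  rewrite (@le_trans _ _ (M%:E * mu (A `&` N))%E)//.
    by rewrite addeC geeDl// leeNl oppe0.
  by rewrite lee_wpmul2l// ?lee_fin// le_measure ?inE.
Qed.

End domination.

Section domination_integral.
Context d (E : measurableType d) (R : realType).
Variables (nu mu : {finite_measure set E -> \bar R}) (M b : R).
Hypotheses (M0 : 0 <= M) (b0 : 0 <= b)
  (numu : forall A, measurable A -> (nu A <= M%:E * mu A + b%:E)%E).

Let fin (m : {finite_measure set E -> \bar R}) : (m [set: E] < +oo)%E.
Proof. by rewrite -ge0_fin_numE// fin_num_measure. Qed.
#[local] Hint Extern 0 (is_true (_ < +oo)%E) => solve [apply: fin] : core.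

Let split_Rintegral (rho kappa : {finite_measure set E -> \bar R}) :
  (forall A, measurable A -> (nu A + kappa A = rho A + M%:E * mu A)%E) ->
  forall u, bmeas u ->
  \int[nu]_x u x + \int[kappa]_x u x = \int[rho]_x u x + M * \int[mu]_x u x.
Proof.
move=> h.
have bI (m : {finite_measure set E -> \bar R}) u : bmeas u ->
    m.-integrable [set: E] (EFin \o u) by move=> bu; exact: bmeas_integrable.
apply: bmeas_ind.
- by move=> u v bu bv /=; rewrite !RintegralB//; try exact: bI; ring.
- by move=> u v bu bv /=; rewrite !RintegralB//; try exact: bI; ring.
move=> u bu u0; apply: EFin_inj.
have mu_ : measurable_fun [set: E] (EFin \o u) by apply/measurable_EFinP; case: bu.
have u0' x : [set: E] x -> (0 <= (EFin \o u) x)%E by rewrite lee_fin.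
rewrite !EFinD EFinM -!bmeas_integralE//.
have := ge0_integral_measure_add nu kappa measurableT u0' mu_.
have := ge0_integral_measure_add rho (mscale (NngNum M0) mu) measurableT u0' mu_.
rewrite ge0_integral_mscale// => <- <-.
apply: eq_measure_integral => A mA _.
by have := h A mA; rewrite -(measure_addE nu kappa) -(measure_addE rho (mscale (NngNum M0) mu)).
Qed.

Lemma dominated_Rintegral (u : E -> R) (C : R) : bmeas u -> (forall x, `|u x| <= C) ->
  `|\int[nu]_x u x| <= M * \int[mu]_x `|u x| + b * C.
Proof.
have [rho [kappa [rb h _]]] := jordan_split M0 numu => bu uC.
have bau := bmeas_norm bu.
have := split_Rintegral h bau.
have k0 : 0 <= \int[kappa]_x `|u x| by exact: Rintegral_ge0.
have C0 : 0 <= C by exact: le_trans (uC point).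
have r1 : \int[rho]_x `|u x| <= C * fine (rho [set: E]) by exact: Rintegral_norm_le.
have r2 : C * fine (rho [set: E]) <= b * C.
  by rewrite mulrC ler_wpM2r// -lee_fin fineK// fin_num_measure.
have := le_norm_Rintegral (fin nu) bu; lra.
Qed.

(** [kappa <= M mu] makes [kappa] absolutely continuous, so [nu - rho = M mu - kappa] has the
    density [g = M - k], with [k] the Radon-Nikodym derivative of [kappa]. What is left without
    density has mass at most [b]. *)
Lemma dominated_density : exists (rho : {finite_measure set E -> \bar R}) (g : E -> R),
  [/\ (rho [set: E] <= b%:E)%E, mu.-integrable [set: E] (EFin \o g) &
    forall u, bmeas u ->
      \int[nu]_x u x = \int[rho]_x u x + \int[mu]_x (u x * g x)].
Proof.
have [rho [kappa [rb h kmu]]] := jordan_split M0 numu.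
have dom : charge_of_finite_measure kappa `<< mu.
  apply/null_content_dominatesP => A mA muA0; apply/eqP.
  by rewrite eq_le measure_ge0 andbT (le_trans (kmu A mA))// muA0 mule0.
pose k := Radon_Nikodym (charge_of_finite_measure kappa) mu.
have kE x : k x = (fine (k x))%:E by rewrite fineK// Radon_Nikodym_fin_num.
have ki : mu.-integrable [set: E] (EFin \o (fun x => fine (k x))).
  rewrite (_ : _ \o _ = k); last by apply/funext => x /=; rewrite -kE.
  exact: Radon_Nikodym_integrable.
exists rho, (fun x => M - fine (k x)); split => //.
  apply: (@integrableB _ _ _ mu _ measurableT (EFin \o cst M)
    (EFin \o (fun x => fine (k x)))) => //.
  by apply: bmeas_integrable => //; exact: bmeas_cst.
move=> u bu; have := split_Rintegral h bu.
have bI (m : {finite_measure set E -> \bar R}) : m.-integrable [set: E] (EFin \o u).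
  exact: bmeas_integrable.
have uk : mu.-integrable [set: E] (EFin \o (fun x => u x * fine (k x))).
  have [mu_ [C uC]] := bu.
  have := @integrableMr _ _ _ mu _ measurableT u (fun x => (fine (k x))%:E) mu_.
  apply => //; exists C; split; first exact: num_real.
  by move=> N CN x _ /=; rewrite (le_trans (uC x))// ltW.
have -> : \int[kappa]_x u x = \int[mu]_x (u x * fine (k x)).
  rewrite /Rintegral -(Radon_Nikodym_change_of_variables dom measurableT (bI kappa)).
  by congr fine; apply: eq_integral => x _; rewrite EFinM -kE.
have -> : \int[mu]_x (u x * (M - fine (k x))) =
    M * \int[mu]_x u x - \int[mu]_x (u x * fine (k x)).
  have bM : bmeas (fun x => M * u x) by exact: bmeasZ.
  rewrite -RintegralZl//; last exact: bI.
  transitivity (\int[mu]_x (M * u x - u x * fine (k x))).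
    by apply: eq_Rintegral => x _; ring.
  by rewrite RintegralB//; exact: bmeas_integrable.
lra.
Qed.

End domination_integral.

(** * Averages over finite partitions *)

Section finite_partition_average.
Context d (E : measurableType d) (R : realType).

Lemma bmeas_sum (I : Type) (s : seq I) (f : I -> E -> R) :
  (forall i, bmeas (f i)) -> bmeas (fun x => \sum_(i <- s) f i x).
Proof.
move=> bf; elim: s => [|i s IH].
  by under eq_fun do rewrite big_nil; exact: bmeas_cst.
by under eq_fun do rewrite big_cons; exact: bmeasD.
Qed.

Lemma Rintegral_sum (mu : {measure set E -> \bar R}) (I : Type) (s : seq I)
    (f : I -> E -> R) : (forall i, mu.-integrable [set: E] (EFin \o f i)) ->
  mu.-integrable [set: E] (EFin \o (fun x => \sum_(i <- s) f i x)) /\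
  \int[mu]_x (\sum_(i <- s) f i x) = \sum_(i <- s) \int[mu]_x f i x.
Proof.
move=> fi; elim: s => [|i s [IHi IH]].
  rewrite big_nil; under eq_fun do rewrite big_nil; split.
    by apply: (@eq_integrable _ _ _ mu _ measurableT (cst 0%E)) => //;
      exact: integrable0.
  by rewrite (_ : (fun=> 0) = cst 0)// /Rintegral integral0.
rewrite big_cons; split; last first.
  by under eq_Rintegral do rewrite big_cons; rewrite RintegralD// IH.
under eq_fun do rewrite big_cons.
exact: (@integrableD _ _ _ mu _ measurableT (EFin \o f i)
  (EFin \o (fun x => \sum_(i <- s) f i x))).
Qed.

Variables (mu : {finite_measure set E -> \bar R}).
Variables (T : finType) (c : E -> T).
Hypothesis mc : forall t, measurable (c @^-1` [set t]).

Let muT : (mu [set: E] < +oo)%E.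
Proof. by rewrite -ge0_fin_numE// fin_num_measure. Qed.

Let bI u : bmeas u -> mu.-integrable [set: E] (EFin \o u).
Proof. exact: bmeas_integrable. Qed.

(** The conditional expectation of [u] given the partition into the fibres of [c]. On a fibre of
    measure zero the division by 0 returns 0. *)
Definition avg (u : E -> R) (x : E) : R :=
  (\int[mu]_(y in c @^-1` [set c x]) u y) / fine (mu (c @^-1` [set c x])).

Lemma measurable_comp_code (h : T -> R) : measurable_fun [set: E] (h \o c).
Proof.
have -> : h \o c = fun x => \sum_(t <- enum T) h t * \1_(c @^-1` [set t]) x.
  apply/funext => x /=; rewrite (bigD1_seq (c x)) ?enum_uniq ?mem_enum//=.
  rewrite indicE mem_set// mulr1 big1 ?addr0// => t tx.
  by rewrite indicE memNset ?mulr0// => /= xt; rewrite xt eqxx in tx.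
apply: measurable_sum => t; apply: measurable_funM => //.
Qed.

Lemma bmeas_comp_code (h : T -> R) : bmeas (h \o c).
Proof.
split; first exact: measurable_comp_code.
exists (\sum_(t : T) `|h t|) => x /=.
by rewrite (bigD1 (c x))//= lerDl sumr_ge0.
Qed.

Lemma bmeas_avg u : bmeas (avg u).
Proof.
exact: (bmeas_comp_code (fun t =>
  (\int[mu]_(y in c @^-1` [set t]) u y) / fine (mu (c @^-1` [set t])))).
Qed.

Lemma le_cell_Rintegral u C t : bmeas u -> (forall x, `|u x| <= C) ->
  `|\int[mu]_(y in c @^-1` [set t]) u y| <= C * fine (mu (c @^-1` [set t])).
Proof.
move=> bu uC; have mt := mc t.
have uI v : bmeas v -> mu.-integrable (c @^-1` [set t]) (EFin \o v).
  by move=> bv; apply: integrableS (bI bv).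
rewrite (le_trans (le_normr_Rintegral _ _))//; first exact: uI.
rewrite -Rintegral_cst//; apply: le_Rintegral => //.
- by apply: uI; exact: bmeas_norm.
- by apply: uI; exact: bmeas_cst.
Qed.

Lemma avg_le u C x : bmeas u -> (forall x, `|u x| <= C) -> `|avg u x| <= C.
Proof.
move=> bu uC; have C0 : 0 <= C by exact: le_trans (uC x).
have m0 : 0 <= fine (mu (c @^-1` [set c x])) by exact: fine_ge0.
rewrite /avg normrM normfV (ger0_norm m0).
have [->|mn0] := eqVneq (fine (mu (c @^-1` [set c x]))) 0; first by rewrite invr0 mulr0.
by rewrite ler_pdivrMr ?lt_neqAle ?[0 == _]eq_sym ?mn0//; exact: le_cell_Rintegral.
Qed.

Lemma avgB u v x : bmeas u -> bmeas v ->
  avg (fun y => u y - v y) x = avg u x - avg v x.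
Proof.
move=> bu bv; rewrite /avg -mulrBl -RintegralB//; apply: integrableS (bI _) => //.
Qed.

Lemma avg_norm u x : bmeas u -> `|avg u x| <= avg (fun y => `|u y|) x.
Proof.
move=> bu; have m0 : 0 <= fine (mu (c @^-1` [set c x])) by exact: fine_ge0.
rewrite /avg normrM normfV (ger0_norm m0).
rewrite ler_wpM2r ?invr_ge0//; apply: le_normr_Rintegral => //.
exact: integrableS (bI _).
Qed.

Lemma Rintegral_comp_code u (h : T -> R) : bmeas u ->
  \int[mu]_x (u x * h (c x)) =
  \sum_(t : T) h t * \int[mu]_(x in c @^-1` [set t]) u x.
Proof.
move=> bu.
have bt t : bmeas (fun x => u x * \1_(c @^-1` [set t]) x).
  have [mu_ [C uC]] := bu; split; first by apply: measurable_funM => //; exact: measurable_indic.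
  exists C => x; rewrite normrM (le_trans _ (uC x))// ler_piMr//.
  by rewrite indicE ger0_norm ?ler0n// lern1 leq_b1.
transitivity (\int[mu]_x (\sum_(t : T) h t * (u x * \1_(c @^-1` [set t]) x))).
  apply: eq_Rintegral => x _; rewrite (bigD1 (c x))//=.
  rewrite indicE mem_set// mulr1 big1 ?addr0 1?mulrC// => t tx.
  by rewrite indicE memNset ?mulr0 ?mulr0// => /= xt; rewrite xt eqxx in tx.
rewrite (Rintegral_sum _ _).2; last by move=> t; apply: bI; exact: bmeasZ.
apply: eq_bigr => t _; rewrite RintegralZl//; last exact: bI.
congr (_ * _); rewrite [RHS]Rintegral_mkcond; apply: eq_Rintegral => x _.
by rewrite patchE indicE; case: ifPn => _; rewrite ?mulr1 ?mulr0.
Qed.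

Lemma cell_Rintegral_avg u t : bmeas u ->
  \int[mu]_(x in c @^-1` [set t]) avg u x = \int[mu]_(x in c @^-1` [set t]) u x.
Proof.
move=> bu; set a := (X in _ = X); set m := fine (mu (c @^-1` [set t])).
have -> : \int[mu]_(x in c @^-1` [set t]) avg u x =
    \int[mu]_(x in c @^-1` [set t]) (a / m).
  by apply: eq_Rintegral => x; rewrite inE/= /avg => ->.
rewrite Rintegral_cst// -/m.
have [m0|m0] := eqVneq m 0; last by rewrite divfK.
rewrite m0 mulr0; apply/esym/eqP; rewrite -normr_eq0 eq_le normr_ge0 andbT.
have [_ [C uC]] := bu.
by rewrite (le_trans (le_cell_Rintegral t bu uC))// -/m m0 mulr0.
Qed.

Lemma Rintegral_avg_comp u (h : T -> R) : bmeas u ->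
  \int[mu]_x (avg u x * h (c x)) = \int[mu]_x (u x * h (c x)).
Proof.
move=> bu; rewrite !Rintegral_comp_code//; last exact: bmeas_avg.
by apply: eq_bigr => t _; rewrite cell_Rintegral_avg.
Qed.

Lemma Rintegral_norm_avg u : bmeas u ->
  \int[mu]_x `|avg u x| <= \int[mu]_x `|u x|.
Proof.
move=> bu; have bau := bmeas_norm bu.
have := Rintegral_avg_comp (fun=> 1) bau.
under eq_Rintegral do rewrite mulr1.
under [in X in _ = X -> _]eq_Rintegral do rewrite mulr1.
move=> <-; apply: le_Rintegral => //.
- by apply: bI; apply: bmeas_norm; exact: bmeas_avg.
- by apply: bI; exact: bmeas_avg.
- by move=> x _; exact: avg_norm.
Qed.

Definition resid u x := u x - avg u x.

Lemma bmeas_resid u : bmeas u -> bmeas (resid u).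
Proof. by move=> bu; apply: bmeasB => //; exact: bmeas_avg. Qed.

Lemma resid_le u C x : bmeas u -> (forall x, `|u x| <= C) -> `|resid u x| <= 2 * C.
Proof.
move=> bu uC; rewrite (le_trans (ler_normB _ _))// mulr_natl mulr2n lerD//.
exact: avg_le.
Qed.

Lemma residB u v x : bmeas u -> bmeas v ->
  resid (fun y => u y - v y) x = resid u x - resid v x.
Proof. by move=> bu bv; rewrite /resid avgB//; ring. Qed.

Lemma Rintegral_norm_resid u : bmeas u ->
  \int[mu]_x `|resid u x| <= 2 * \int[mu]_x `|u x|.
Proof.
move=> bu; have bau := bmeas_norm bu.
have bav := bmeas_norm (bmeas_avg u).
rewrite mulr_natl mulr2n (@le_trans _ _ (\int[mu]_x (`|u x| + `|avg u x|)))//.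
  apply: le_Rintegral => //; last by move=> x _; exact: ler_normB.
    by apply: bI; apply: bmeas_norm; exact: bmeas_resid.
  by apply: bI; exact: bmeasD.
rewrite RintegralD//; [|exact: bI|exact: bI].
by rewrite lerD2l; exact: Rintegral_norm_avg.
Qed.

Lemma Rintegral_resid_comp u (h : T -> R) : bmeas u ->
  \int[mu]_x (resid u x * h (c x)) = 0.
Proof.
move=> bu; have bM v : bmeas v -> mu.-integrable [set: E] (EFin \o (fun x => v x * h (c x))).
  move=> [mv [C vC]]; apply: bI; split.
    by apply: measurable_funM => //; exact: measurable_comp_code.
  have [_ [D hD]] := bmeas_comp_code h.
  by exists (C * D) => x; rewrite normrM; apply: ler_pM => //; exact: hD.
under eq_Rintegral do rewrite mulrBl.
rewrite RintegralB//; [|exact: bM|by apply: bM; exact: bmeas_avg].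
by rewrite Rintegral_avg_comp// subrr.
Qed.

End finite_partition_average.

(** * Averages over the partitions defined by the first generators *)

Section generated_partitions.
Context d (E : measurableType d) (R : realType).
Variable G : nat -> set E.
Hypothesis GE : @measurable d E = <<s range G >>.

Let mG n : measurable (G n).
Proof. by rewrite GE; apply: sub_sigma_algebra; exists n. Qed.

Definition generator_code n (x : E) : {ffun 'I_n -> bool} := [ffun i : 'I_n => x \in G i].

Lemma measurable_code n t : measurable (generator_code n @^-1` [set t]).
Proof.
have -> : generator_code n @^-1` [set t] =
    \bigcap_(i in [set: 'I_n]) (if t i then G i else ~` G i).
  apply/seteqP; split => [x /= <- i _|x xt] /=.
    by rewrite ffunE; case: ifPn => [/set_mem//|/negP xG] => /mem_set.
  apply/ffunP => i; rewrite ffunE; have := xt i I.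
  by case: ifPn => ti xG; [rewrite mem_set|rewrite memNset].
apply: fin_bigcap_measurable => [|i _]; first exact: finite_finset.
by case: ifPn => _; [|apply: measurableC].
Qed.

Lemma code_widen m n (mn : (m <= n)%N) x :
  generator_code m x = [ffun i : 'I_m => generator_code n x (widen_ord mn i)].
Proof. by apply/ffunP => i; rewrite !ffunE. Qed.

Variable mu : {finite_measure set E -> \bar R}.

Let muT : (mu [set: E] < +oo)%E.
Proof. by rewrite -ge0_fin_numE// fin_num_measure. Qed.

Let bI u : bmeas u -> mu.-integrable [set: E] (EFin \o u).
Proof. exact: bmeas_integrable. Qed.

(* The averages over finer and finer partitions converge to the identity in
   L^1 duality with [g], uniformly over the unit ball. *)
Definition resid_cvg (g : E -> R) := forall e : R, 0 < e ->
  \forall n \near \oo, forall u, bmeas u -> (forall x, `|u x| <= 1) ->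
    `|\int[mu]_x (resid mu (generator_code n) u x * g x)| <= e.

Lemma integrable_bmeasM u g : bmeas u -> mu.-integrable [set: E] (EFin \o g) ->
  mu.-integrable [set: E] (EFin \o (fun x => u x * g x)).
Proof.
move=> [mu_ [C uC]] gi.
have := @integrableMr _ _ _ mu _ measurableT u (EFin \o g) mu_.
apply => //; exists C; split; first exact: num_real.
by move=> N CN x _ /=; rewrite (le_trans (uC x))// ltW.
Qed.

(** The functions satisfying [resid_cvg] form a closed set in [L^1(mu)], because the residuals of
    the unit ball are bounded by 2 whatever [u] and [n]; this doubles [e / 4] to [e / 2]. *)
Lemma resid_cvg_approx g : mu.-integrable [set: E] (EFin \o g) ->
  (forall e : R, 0 < e -> exists h, [/\ mu.-integrable [set: E] (EFin \o h),
    resid_cvg h & \int[mu]_x `|g x - h x| <= e]) -> resid_cvg g.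
Proof.
move=> gi gh e e0; have [|h [hi hcvg gh4]] := gh (e / 4); first by rewrite divr_gt0.
have e2 : 0 < e / 2 by rewrite divr_gt0.
apply: filterS (hcvg _ e2) => n hn u bu u1.
have br : bmeas (resid mu (generator_code n) u) by apply: bmeas_resid => //; exact: measurable_code.
have ri := integrable_bmeasM br hi; have rg := integrable_bmeasM br gi.
have ghi : mu.-integrable [set: E] (EFin \o (fun x => g x - h x)).
  exact: (@integrableB _ _ _ mu _ measurableT (EFin \o g) (EFin \o h)).
have rgh := integrable_bmeasM br ghi.
have -> : \int[mu]_x (resid mu (generator_code n) u x * g x) =
    \int[mu]_x (resid mu (generator_code n) u x * h x) +
    \int[mu]_x (resid mu (generator_code n) u x * (g x - h x)).
  by rewrite -RintegralD//; apply: eq_Rintegral => x _; ring.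
rewrite (le_trans (ler_normD _ _))// [leRHS]splitr lerD//; first exact: hn.
rewrite (le_trans (le_normr_Rintegral _ _))//.
have agh : mu.-integrable [set: E] (EFin \o (fun x => `|g x - h x|)).
  by have := integrable_norm ghi.
rewrite (@le_trans _ _ (\int[mu]_x (2 * `|g x - h x|)))//.
  apply: le_Rintegral => //.
  - by have := integrable_norm rgh.
  - exact: (integrable_bmeasM (bmeas_cst E (2 : R)) agh).
  - move=> x _; rewrite normrM ler_wpM2r// -[2]mulr1.
    by apply: resid_le => //; exact: measurable_code.
by rewrite RintegralZl//; lra.
Qed.

Lemma resid_cvgD g h : mu.-integrable [set: E] (EFin \o g) ->
  mu.-integrable [set: E] (EFin \o h) ->
  resid_cvg g -> resid_cvg h -> resid_cvg (fun x => g x + h x).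
Proof.
move=> gi hi gc hc e e0; have e2 : 0 < e / 2 by rewrite divr_gt0.
near=> n => u bu u1.
have br : bmeas (resid mu (generator_code n) u) by apply: bmeas_resid => //; exact: measurable_code.
under eq_Rintegral do rewrite mulrDr.
rewrite RintegralD//; [|exact: integrable_bmeasM|exact: integrable_bmeasM].
rewrite (le_trans (ler_normD _ _))// [leRHS]splitr lerD//.
  by move: u bu u1 {br}; near: n; exact: gc.
by move: u bu u1 {br}; near: n; exact: hc.
Unshelve. all: by end_near.
Qed.

Lemma resid_cvgZ a g : mu.-integrable [set: E] (EFin \o g) ->
  resid_cvg g -> resid_cvg (fun x => a * g x).
Proof.
move=> gi gc e e0.
have a1 : 0 < `|a| + 1 by rewrite ltr_wpDl.
have e2 : 0 < e / (`|a| + 1) by rewrite divr_gt0.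
apply: filterS (gc _ e2) => n hn u bu u1.
have br : bmeas (resid mu (generator_code n) u) by apply: bmeas_resid => //; exact: measurable_code.
under eq_Rintegral do rewrite mulrCA.
rewrite RintegralZl//; last exact: integrable_bmeasM.
have := hn u bu u1; rewrite ler_pdivlMr// => h.
rewrite normrM mulrC (le_trans _ h)// ler_wpM2l// lerDl//.
Qed.

(** Once [m >= n], the function is constant on the cells of order [m], against which residuals
    integrate to 0: the integral vanishes for all [u] at once. For [n = 0] there is a single cell,
    which gives the constants. *)
Lemma resid_cvg_code n (h : {ffun 'I_n -> bool} -> R) : resid_cvg (h \o generator_code n).
Proof.
move=> e e0; exists n => // m /= nm u bu u1.
have -> : \int[mu]_x (resid mu (generator_code m) u x * (h \o generator_code n) x) = 0.
  rewrite -[RHS](Rintegral_resid_comp mu (measurable_code (n := m))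
    (fun t => h [ffun i => t (widen_ord nm i)]) bu).
  by apply: eq_Rintegral => x _ /=; rewrite (code_widen nm x).
by rewrite normr0 ltW.
Qed.

Lemma measurable_code_set n (p : {ffun 'I_n -> bool} -> bool) :
  measurable [set x | p (generator_code n x)].
Proof.
rewrite (_ : [set x | p (generator_code n x)] = \bigcup_(t in [set t | p t]) generator_code n @^-1` [set t]).
  by apply: fin_bigcup_measurable => [|t _];
    [exact: finite_finset|exact: measurable_code].
by apply/seteqP; split => [x px|x [t /= pt ->//]]; exists (generator_code n x).
Qed.

Lemma resid_cvgU A B : measurable A -> measurable B -> [disjoint A & B] ->
  resid_cvg \1_A -> resid_cvg \1_B -> resid_cvg \1_(A `|` B).
Proof.
move=> mA mB dAB cA cB.
have -> : \1_(A `|` B) = (fun x => \1_A x + \1_B x) :> (E -> R).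
  apply/funext => x; rewrite !indicE in_setU.
  have [xA|] := boolP (x \in A); have [xB|] := boolP (x \in B);
    rewrite ?addr0 ?add0r//.
  by move/disj_setPRL : dAB => /(_ x (set_mem xB)) /(_ (set_mem xA)).
by apply: resid_cvgD => //; apply: bI; exact: bmeas_indic.
Qed.

Lemma resid_cvg_indic A : measurable A -> resid_cvg \1_A.
Proof.
(* The unions of cells of some order form a generating pi-system, on which [resid_cvg_code]
   applies. *)
pose C := [set A | exists n (p : {ffun 'I_n -> bool} -> bool), A = [set x | p (generator_code n x)]].
have CE : @measurable d E = <<s C >>.
  apply/seteqP; split => S.
    rewrite {1}GE; apply: smallest_sub; first exact: smallest_sigma_algebra.
    move=> _ [k _ <-]; apply: sub_sigma_algebra; exists k.+1, (fun t => t ord_max).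
    apply/seteqP; split => x /=; rewrite ffunE; first by move/mem_set.
    by move/set_mem.
  apply: smallest_sub; first exact: sigma_algebra_measurable.
  by move=> _ [n [p ->]]; exact: measurable_code_set.
have CP n (p : {ffun 'I_n -> bool} -> bool) : resid_cvg \1_[set x | p (generator_code n x)].
  rewrite (_ : \1_ _ = (fun t => (p t)%:R) \o generator_code n); first exact: resid_cvg_code.
  apply/funext => x; rewrite indicE/=.
  have [px|/negP px] := boolP (p (generator_code n x)); first by rewrite mem_set.
  by rewrite memNset.
move=> mA; have := mA; rewrite {1}CE; move: A {mA}.
apply: (dynkin_induction (P := fun A => resid_cvg \1_A) CE).
- move=> _ _ [m [p ->]] [n [q ->]].
  exists (maxn m n), (fun t =>
    p [ffun i => t (widen_ord (leq_maxl m n) i)] &&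
    q [ffun i => t (widen_ord (leq_maxr m n) i)]).
  apply/seteqP; split => x /=; rewrite -!code_widen.
    by case=> -> ->.
  by move/andP.
- have := CP 0%N xpredT.
  by rewrite (_ : [set x | _] = setT)//; apply/seteqP; split.
- by move=> _ [n [p ->]].
- move=> S mS Sc.
  have -> : \1_(~` S) = (fun x => 1 + (-1) * \1_S x) :> (E -> R).
    apply/funext => x; rewrite !indicE in_setC.
    by case: (x \in S); rewrite ?mulr1 ?mulr0 ?addr0 ?subrr.
  apply: resid_cvgD; [exact: bI (bmeas_cst _ _)| | |].
  + by apply: bI; apply: bmeasZ; exact: bmeas_indic.
  + exact: (@resid_cvg_code 0 (fun=> 1)).
  + by apply: resid_cvgZ => //; apply: bI; exact: bmeas_indic.
- move=> F mF tF Fc.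
  pose U n := \big[setU/set0]_(i < n) F i.
  have mU n : measurable (U n) by exact: bigsetU_measurable.
  have mBF : measurable (\bigcup_k F k) by exact: bigcup_measurable.
  have Uc n : resid_cvg \1_(U n).
    elim: n => [|n IH].
      rewrite /U big_ord0 (_ : \1_set0 = fun=> 0).
        exact: (@resid_cvg_code 0 (fun=> 0)).
      by apply/funext => x; rewrite indicE in_set0.
    have -> : U n.+1 = U n `|` F n by rewrite /U big_ord_recr.
    apply: resid_cvgU => //; apply/disj_setPS.
    rewrite /U -bigcup_mkord => x [[i /= iltn Fix] Fnx].
    have := tF i n I I (ex_intro _ x (conj Fix Fnx)).
    by move=> /eqP; rewrite ltn_eqF.
  (* [B n] decreases to the empty set and [mu] is finite, so the finite unions [U n] approximate the
     countable one in [L^1(mu)]. *)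
  pose B n := \bigcup_k F k `\` U n.
  have mB n : measurable (B n) by exact: measurableD.
  have B0 : \bigcap_n B n = set0.
    apply/seteqP; split => // x xB; have [[k _ Fkx] _] := xB 0%N I.
    have [_] := xB k.+1 I; apply; rewrite /U -bigcup_mkord.
    by exists k => /=.
  have cB : mu \o B @ \oo --> 0%E.
    rewrite -(measure0 mu) -B0; apply: nonincreasing_cvg_mu => //.
    + by rewrite -ge0_fin_numE// fin_num_measure.
    + by rewrite B0.
    + move=> m n mn; apply/subsetPset; apply: setDS.
      by rewrite /U -!bigcup_mkord; apply: bigcup_sub => k /= km;
        apply: bigcup_sup => /=; exact: leq_trans mn.
  apply: resid_cvg_approx; first by apply: bI; exact: bmeas_indic.
  move=> e e0.
  have /fine_cvgP[_ /cvgrPdist_lt /(_ e e0) [n _ Bn]] := cB.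
  exists \1_(U n); split => //; first by apply: bI; exact: bmeas_indic.
  have -> : \int[mu]_x `|\1_(\bigcup_k F k) x - \1_(U n) x| = \int[mu]_x \1_(B n) x.
    apply: eq_Rintegral => x _; rewrite /B !indicE in_setD.
    have [xU|xU] := boolP (x \in U n); last by rewrite subr0 andbT ger0_norm ?ler0n.
    rewrite mem_set ?subrr ?normr0//.
    by move/set_mem : xU; rewrite /U -bigcup_mkord => -[k _ Fkx]; exists k.
  rewrite /Rintegral integral_indic// setIT.
  have := Bn n (leqnn n); rewrite /= sub0r normrN => /ltW.
  by rewrite ger0_norm// fine_ge0.
Qed.

Import HBSimple.

(** Simple functions are dense in [L^1(mu)]. As averaging is self-adjoint, the statement amounts to
    convergence of the averages of [g] to [g] in [L^1(mu)], whence the uniformity in [u]. *)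
Lemma resid_cvg_integrable g : mu.-integrable [set: E] (EFin \o g) -> resid_cvg g.
Proof.
move=> gi; apply: resid_cvg_approx => // e e0.
have [f [fi _ fl]] := approximation_sfun_integrable measurableT gi.
have /fine_cvgP[_ /cvgrPdist_lt /(_ e e0) [n _ fn]] := fl.
exists (f n); split; first exact: fi.
  have -> : (f n : E -> R) =
      fun x => \sum_(y <- fset_set (range (f n))) y * \1_(f n @^-1` [set y]) x.
    by apply/funext => x; rewrite fimfunE fsbig_finite.
  have iy y : mu.-integrable [set: E] (EFin \o (fun x => y * \1_(f n @^-1` [set y]) x)).
    by apply: bI; apply: bmeasZ; apply: bmeas_indic.
  elim: (enum_fset (fset_set (range (f n)))) => [|y s IH].
    under eq_fun do rewrite big_nil.
    exact: (@resid_cvg_code 0 (fun=> 0)).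
  under eq_fun do rewrite big_cons.
  apply: resid_cvgD => //; first by have [] := Rintegral_sum s iy.
  apply: resid_cvgZ; first by apply: bI; apply: bmeas_indic.
  exact: resid_cvg_indic.
have := fn n (leqnn n); rewrite /= sub0r normrN => /ltW.
by apply: le_trans; rewrite (le_trans _ (ler_norm _)).
Qed.

End generated_partitions.

(** * Finite kernels *)

Import KCOMP_FINITE_KERNEL.

Section finite_kernels.
Context d (E : measurableType d) (R : realType).
Implicit Types N : R.-fker E ~> E.

(** A copy of [m] carrying the proof of finiteness, so that [N x] can be used as a
    [finite_measure]. *)
Definition as_finite (m : {measure set E -> \bar R})
  (mT : (m [set: E] < +oo)%E) : set E -> \bar R := m.

HB.instance Definition _ m mT := Measure.copy (@as_finite m mT) m.

Let as_finite_fin m mT : fin_num_fun (@as_finite m mT).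
Proof. exact: lty_fin_num_fun. Qed.

HB.instance Definition _ m mT :=
  Measure_isFinite.Build _ _ _ (@as_finite m mT) (@as_finite_fin m mT).

Lemma fker_bound N : exists2 C, 1 <= C & forall x, (N x [set: E] <= C%:E)%E.
Proof.
have [C NC] := measure_uub N; exists (Num.max 1 C); first by rewrite le_max lexx.
by move=> x; rewrite (le_trans (ltW (NC x)))// lee_fin le_max lexx orbT.
Qed.

Lemma fker_fin_num N x A : measurable A -> N x A \is a fin_num.
Proof. by move=> mA; exact: (finite_kernel_measure N x). Qed.

Definition vanishing (A : nat -> set E) := [/\ forall n, measurable (A n),
  nonincreasing_seq A & \bigcap_n A n = set0].

Definition uniformly_vanishing N b := forall A, vanishing A ->
  exists n, forall x, (N x (A n) <= b%:E)%E.

(* Otherwise, choose greedily points X n and sets A n with N(X n, A n) > b and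
   sum_(j < n) N(X j, A n) = O(2^-n). By Borel-Cantelli the limsup of the A n is
   null for every N(X j, .), and removing it from the tails of (A n) gives a
   sequence that contradicts uniform vanishing. *)
Lemma uniformly_vanishing_dominated N b : 0 <= b -> uniformly_vanishing N b ->
  exists (s : seq E) (M : R), 0 <= M /\ forall x A, measurable A ->
    (N x A <= M%:E * \sum_(y <- s) N y A + b%:E)%E.
Proof.
move=> b0 Nb; apply: contrapT => hN.
have [C C1 NC] := fker_bound N.
have C0 : 0 <= C by rewrite (le_trans _ C1).
have NCA x A : measurable A -> (N x A <= C%:E)%E.
  by move=> mA; rewrite (le_trans _ (NC x))//; apply: le_measure; rewrite ?inE.
(* Domination by the points of [s] fails in particular for the constant [2 ^ (size s).+1]; along the
   lists [L n], of size [n], this gives the geometric decay. *)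
have ch (s : seq E) : exists xA : E * set E, measurable xA.2 /\
    (((2 ^ (size s).+1)%:R : R)%:E * \sum_(y <- s) N y xA.2 + b%:E < N xA.1 xA.2)%E.
  apply: contrapT => hs; apply: hN; exists s, ((2 ^ (size s).+1)%:R).
  split => // x A mA; rewrite leNgt; apply/negP => h.
  by apply: hs; exists (x, A).
have {ch}[F HF] := choice ch.
pose L := fix L n := if n is n'.+1 then (F (L n')).1 :: L n' else [::].
have sL n : size (L n) = n by elim: n => //= n ->.
pose X n := (F (L n)).1; pose A n := (F (L n)).2.
have mA n : measurable (A n) by have [] := HF (L n).
have XL j n : (j < n)%N -> X j \in L n.
  elim: n => // n IH; rewrite ltnS leq_eqVlt => /predU1P[->|/IH jn].
    by rewrite /= in_cons eqxx.
  by rewrite /= in_cons jn orbT.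
have NA n : (b%:E < N (X n) (A n))%E.
  have [_] := HF (L n); apply: le_lt_trans.
  by rewrite leeDr// mule_ge0 ?lee_fin// sume_ge0.
have NXA j n : (j < n)%N -> (N (X j) (A n) <= (C / (2 ^ n.+1)%:R)%:E)%E.
  move=> jn; have [_ h] := HF (L n).
  have p0 : (0 : R) < (2 ^ n.+1)%:R by rewrite ltr0n expn_gt0.
  rewrite EFinM lee_pdivlMr// muleC.
  rewrite sL -/(A n) -/(X n) in h.
  rewrite (le_trans _ (NCA (X n) (A n) (mA n)))// (le_trans _ (ltW h))//.
  rewrite (@le_trans _ _ ((2 ^ n.+1)%:R%:E * \sum_(y <- L n) N y (A n))%E)//; last first.
    by rewrite leeDl// lee_fin.
  rewrite lee_wpmul2l ?lee_fin//.
  have /path.splitPr [s1 s2] := XL _ _ jn.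
  by rewrite big_cat big_cons/= addeCA leeDl// adde_ge0// sume_ge0.
(* The factor [2 ^ j.+1] extends the bound to [n <= j], where only [N (X j) (A n) <= C] is known, so
   that the whole series is controlled. *)
have NXA2 j n : (N (X j) (A n) <= (C * (2 ^ j.+1)%:R / (2 ^ n.+1)%:R)%:E)%E.
  have [jn|nj] := ltnP j n.
    rewrite (le_trans (NXA _ _ jn))// lee_fin ler_pM2r ?invr_gt0 ?ltr0n ?expn_gt0//.
    by rewrite ler_peMr// ler1n expn_gt0.
  rewrite (le_trans (NCA _ _ (mA n)))// lee_fin -mulrA ler_peMr//.
  by rewrite ler_pdivlMr ?ltr0n ?expn_gt0// mul1r ler_nat leq_pexp2l.
have null j : N (X j) (lim_sup_set A) = 0%E.
  apply: lim_sup_set_cvg0 => //.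
  rewrite (@le_lt_trans _ _ (\sum_(n <oo) (C * (2 ^ j.+1)%:R / (2 ^ n.+1)%:R)%:E)%E)//.
    by apply: lee_nneseries => // n _; exact: NXA2.
  by rewrite (le_lt_trans (epsilon_trick0 _ _))// ?ltry// mulr_ge0.
have mB n : measurable (\bigcup_(j >= n) A j) by exact: bigcup_measurable.
have mS : measurable (lim_sup_set A) by exact: bigcap_measurable.
have [] := Nb (fun n => (\bigcup_(j >= n) A j) `\` lim_sup_set A).
  split.
  - by move=> n; exact: measurableD.
  - move=> m n mn; apply/subsetPset; apply: setSD.
    by apply: bigcup_sub => k /= nk; apply: bigcup_sup => /=; exact: leq_trans nk.
  - apply/seteqP; split => // x xB.
    have [_] := xB 0%N I; apply => n _.
    by have [] := xB n I.
move=> n /(_ (X n)); apply/negP; rewrite -ltNge (lt_le_trans (NA n))//.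
rewrite (@le_trans _ _ (N (X n) ((\bigcup_(j >= n) A j `\` lim_sup_set A) `|` lim_sup_set A)))//.
  apply: le_measure; rewrite ?inE//; first by apply: measurableU => //; exact: measurableD.
  move=> x Ax; have [xS|xS] := pselect (lim_sup_set A x); first by right.
  by left; split => //; exists n => /=.
rewrite (le_trans (measureU2 _ _ _))//; first exact: measurableD.
by rewrite [X in (_ + X)%E]null adde0.
Qed.

(** [mkcomp] composes with a kernel that may also depend on the starting point; ignoring the first
    coordinate gives the usual product of kernels. *)
Definition ksnd N : E * E -> {measure set E -> \bar R} := fun xy => N xy.2.

Let measurable_ksnd N U : measurable U -> measurable_fun [set: E * E] (ksnd N ^~ U).
Proof.
by move=> mU; apply: (measurableT_comp (measurable_kernel N _ mU)).
Qed.

HB.instance Definition _ N := isKernel.Build _ _ _ _ _ (ksnd N) (@measurable_ksnd N).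

Let ksnd_uub N : measure_fam_uub (ksnd N).
Proof. by have [C NC] := measure_uub N; exists C => -[x y]; exact: NC. Qed.

HB.instance Definition _ N := Kernel_isFinite.Build _ _ _ _ _ (ksnd N) (ksnd_uub N).

(* [kpow N n] is the power [N ^ (n + 1)]. *)
Fixpoint kpow N n : R.-fker E ~> E :=
  if n is n'.+1 then (mkcomp (kpow N n') (ksnd N) : R.-fker E ~> E) else N.

Lemma integral_kpowS N n x (f : E -> \bar R) :
  (forall y, (0 <= f y)%E) -> measurable_fun [set: E] f ->
  (\int[kpow N n.+1 x]_y f y = \int[kpow N n x]_y \int[N y]_z f z)%E.
Proof. by move=> f0 mf; rewrite /= integral_kcomp. Qed.

End finite_kernels.

(** * Construction of an excessive measure *)

Section excessive_measure.
Context d (E : measurableType d) (R : realType).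
Implicit Types N : R.-fker E ~> E.

Lemma kpow_bound N C n x : 0 <= C -> (forall x, (N x [set: E] <= C%:E)%E) ->
  (kpow N n x [set: E] <= (C ^+ n.+1)%:E)%E.
Proof.
move=> C0 NC; elim: n => [|n IH] in x *; first by rewrite expr1.
have -> : kpow N n.+1 x [set: E] = (\int[kpow N n x]_y N y [set: E])%E by [].
rewrite (@le_trans _ _ (\int[kpow N n x]_y C%:E)%E)//.
  by apply: ge0_le_integral => //; exact: measurable_kernel.
by rewrite integral_cst// exprS EFinM lee_wpmul2l.
Qed.

Variables (N : R.-fker E ~> E) (s : seq E).

(* [sum_k r^k sum_(y <- s) N^(k+1)(y, .)], with [r] so small that it is finite *)
Lemma excessive_measure : exists (mu : {finite_measure set E -> \bar R}) (K : R),
  [/\ 0 <= K, forall A, measurable A -> (\sum_(y <- s) N y A <= mu A)%E &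
    forall f : E -> \bar R, (forall x, (0 <= f x)%E) -> measurable_fun [set: E] f ->
      (\int[mu]_x \int[N x]_y f y <= K%:E * \int[mu]_x f x)%E].
Proof.
have [C C1 NC] := fker_bound N.
have C0 : 0 < C by rewrite (lt_le_trans _ C1).
(* The [k]-th term of the series has mass at most [r ^+ k * (size s)%:R * C ^+ k.+1], that is
   [(size s)%:R * C / 2 ^ k]. *)
pose r := (2 * C)^-1.
have r0 : 0 < r by rewrite invr_gt0 mulr_gt0.
have rk k : 0 <= r ^+ k by rewrite exprn_ge0// ltW.
pose S k : {measure set E -> \bar R} :=
  msum (fun j => kpow N k (nth point s j) : {measure set E -> \bar R}) (size s).
pose m k : {measure set E -> \bar R} := mscale (NngNum (rk k)) (S k).
have SE k A : S k A = (\sum_(y <- s) kpow N k y A)%E.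
  by rewrite (big_nth point) big_mkord.
have intS k f : (forall x, (0 <= f x)%E) -> measurable_fun [set: E] f ->
    (\int[S k]_x f x = \sum_(y <- s) \int[kpow N k y]_x f x)%E.
  move=> f0 mf; rewrite ge0_integral_measure_sum//.
  by rewrite (big_nth point) big_mkord.
pose nu : {measure set E -> \bar R} := mseries m 0.
have nuE A : nu A = (\sum_(0 <= k <oo) ((r ^+ k)%:E * S k A))%E by [].
have nuT : (nu [set: E] < +oo)%E.
  pose c : R := 2 * ((size s)%:R * C).
  have c0 : 0 <= c by rewrite !mulr_ge0// ltW.
  rewrite nuE (@le_lt_trans _ _ (\sum_(k <oo) (c / (2 ^ k.+1)%:R)%:E)%E)//.
    apply: lee_nneseries => [k _ _|k _].
      by rewrite mule_ge0// lee_fin.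
    rewrite SE (@le_trans _ _ ((r ^+ k)%:E * \sum_(y <- s) (C ^+ k.+1)%:E)%E)//.
      by rewrite lee_wpmul2l ?lee_fin//; apply: lee_sum => y _; apply: kpow_bound => //; exact: ltW.
    rewrite sumEFin -EFinM lee_fin big_const_seq count_predT iter_addr_0 -mulr_natl /c /r.
    rewrite le_eqVlt; apply/orP; left; apply/eqP.
    rewrite natrX exprVn exprMn !exprS; field.
    by rewrite !expf_neq0 ?gt_eqF.
  by rewrite (le_lt_trans (epsilon_trick0 _ _))// ltry.
have intnu f : (forall x, (0 <= f x)%E) -> measurable_fun [set: E] f ->
    (\int[nu]_x f x = \sum_(0 <= k <oo) ((r ^+ k)%:E * \int[S k]_x f x))%E.
  move=> f0 mf; rewrite ge0_integral_measure_series//.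
  by apply: eq_eseriesr => k _; rewrite ge0_integral_mscale.
(* [N] shifts the series by one rank and [r^-1] restores the weights; the first term, which is lost,
   is nonnegative. *)
exists (as_finite nuT), r^-1; split; first by rewrite invr_ge0 ltW.
  move=> A mA; rewrite [leRHS]nuE nneseries_recl//; last first.
    by move=> k _; rewrite mule_ge0// lee_fin.
  rewrite expr0 mul1e SE leeDl//.
  by apply: nneseries_ge0 => k _ _; rewrite mule_ge0// lee_fin.
move=> f f0 mf.
have mNf : measurable_fun [set: E] (fun x => \int[N x]_y f y)%E.
  by apply: measurable_fun_integral_kernel => //; exact: measurable_kernel.
have Nf0 x : (0 <= \int[N x]_y f y)%E by exact: integral_ge0.
have -> : (\int[as_finite nuT]_x \int[N x]_y f y = \int[nu]_x \int[N x]_y f y)%E by [].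
have -> : (\int[as_finite nuT]_x f x = \int[nu]_x f x)%E by [].
rewrite !intnu//.
have i0 k g : (forall x, (0 <= g x)%E) -> (0 <= (r ^+ k)%:E * \int[S k]_x g x)%E.
  by move=> g0; rewrite mule_ge0 ?lee_fin// integral_ge0.
have i1 k : (0 <= (r^-1)%:E * ((r ^+ k)%:E * \int[S k]_x f x))%E.
  by apply: mule_ge0; [rewrite lee_fin invr_ge0 ltW|exact: i0].
rewrite -nneseriesZl//; last by move=> k _; exact: i0.
rewrite [leRHS]nneseries_recl// -nneseries_addn//.
rewrite (_ : (\sum_(0 <= k <oo) ((r ^+ k)%:E * \int[S k]_x \int[N x]_y f y) =
  \sum_(k <oo) ((r^-1)%:E * ((r ^+ (k + 1))%:E * \int[S (k + 1)%N]_x f x)))%E).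
  by rewrite leeDr//; exact: (i1 0%N).
apply: eq_eseriesr => k _; rewrite muleA -EFinM addn1 exprS mulKf ?gt_eqF//.
congr (_ * _)%E; rewrite !intS//.
by apply: eq_bigr => y _; rewrite integral_kpowS.
Qed.

End excessive_measure.

Section clamp.
Context {R : realType}.
Implicit Types a t e x y : R.

(* [t] truncated to [[-a, a]] *)
Definition clamp a t := (`|t + a| - `|t - a|) / 2.

Let nP t : (0 <= t /\ `|t| = t) \/ (t <= 0 /\ `|t| = - t).
Proof.
by have [t0|/ltW t0] := leP 0 t; [left; rewrite ger0_norm|right; rewrite ler0_norm].
Qed.

Lemma clamp_le a t : 0 <= a -> `|clamp a t| <= a.
Proof.
rewrite /clamp => a0; rewrite ler_norml.
have := nP (t + a); have := nP (t - a) => -[[h1 ->]|[h1 ->]] [[h2 ->]|[h2 ->]];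
  by apply/andP; split; lra.
Qed.

Lemma dist_clamp_le a e t : 0 <= a -> 0 <= e -> `|t| <= a + e ->
  `|t - clamp a t| <= e.
Proof.
rewrite /clamp => a0 e0; rewrite !ler_norml => /andP[t1 t2].
have := nP (t + a); have := nP (t - a) => -[[h1 ->]|[h1 ->]] [[h2 ->]|[h2 ->]];
  by apply/andP; split; lra.
Qed.

(** [t - clamp a t] is the soft threshold of [t] at level [a], a 1-Lipschitz function of [t]. *)
Lemma dist_clampD a x y : 0 <= a ->
  `|(x + y) - clamp a (x + y)| <= `|x - clamp a x| + `|y|.
Proof.
rewrite /clamp => a0.
have := nP (x + y + a); have := nP (x + y - a); have := nP (x + a);
have := nP (x - a); have := nP y;
  by move=> -[[h1 ->]|[h1 ->]] [[h2 ->]|[h2 ->]] [[h3 ->]|[h3 ->]]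
  [[h4 ->]|[h4 ->]] [[h5 ->]|[h5 ->]];
  match goal with |- is_true (`|?s| <= `|?t| + _) =>
    have := nP s; have := nP t end;
  move=> -[[h6 ->]|[h6 ->]] [[h7 ->]|[h7 ->]]; lra.
Qed.

Lemma dist_clampM a c t : 0 <= c ->
  `|c * t - clamp (c * a) (c * t)| = c * `|t - clamp a t|.
Proof.
move=> c0; rewrite /clamp -mulrDr -mulrBr !normrM (ger0_norm c0) -mulrBr -mulrA.
by rewrite -mulrBr normrM (ger0_norm c0).
Qed.

End clamp.

Section kernel_operator_real.
Context d (E : measurableType d) (R : realType).
Variable N : R.-fker E ~> E.

Let NT x : (N x [set: E] < +oo)%E.
Proof. by rewrite -ge0_fin_numE//; exact: fker_fin_num. Qed.

Definition kernel_mean (u : E -> R) (x : E) : R := \int[N x]_y u y.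

Lemma measurable_kernel_mean u : bmeas u -> measurable_fun [set: E] (kernel_mean u).
Proof.
move=> [mu _]; have mEu : measurable_fun [set: E] (EFin \o u) by exact/measurable_EFinP.
apply: measurableT_comp => //; under eq_fun do rewrite integralE.
apply: emeasurable_funB; apply: measurable_fun_integral_kernel => //.
- exact: measurable_kernel.
- exact: measurable_funepos.
- exact: measurable_kernel.
- exact: measurable_funeneg.
Qed.

Lemma kernel_mean_le C a u x : bmeas u -> (forall x, `|u x| <= a) -> (N x [set: E] <= C%:E)%E ->
  `|kernel_mean u x| <= C * a.
Proof.
move=> bu ua NC; rewrite (le_trans (norm_Rintegral_le _ _ ua))// mulrC.
rewrite ler_wpM2r//; first exact: le_trans (ua point).
by rewrite -lee_fin fineK//; exact: fker_fin_num.
Qed.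

Lemma bmeas_kernel_mean u : bmeas u -> bmeas (kernel_mean u).
Proof.
move=> bu; split; first exact: measurable_kernel_mean.
have [_ [a ua]] := bu; have [C _ NC] := fker_bound N.
by exists (C * a) => x; exact: kernel_mean_le.
Qed.

Lemma kernel_meanB u v x : bmeas u -> bmeas v ->
  kernel_mean (fun y => u y - v y) x = kernel_mean u x - kernel_mean v x.
Proof. by move=> bu bv; rewrite /kernel_mean RintegralB//; exact: bmeas_integrable. Qed.

Lemma kernel_meanZ c u x : bmeas u -> kernel_mean (fun y => c * u y) x = c * kernel_mean u x.
Proof. by move=> bu; rewrite /kernel_mean RintegralZl//; exact: bmeas_integrable. Qed.

End kernel_operator_real.

(** * Iterates of the kernel applied to residuals *)

Section residual_iterates.
Context d (E : measurableType d) (R : realType).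
Implicit Types (u v : E -> R) (a e : R).
Variables (N : R.-fker E ~> E) (G : nat -> set E).
Hypothesis GE : @measurable d E = <<s range G >>.
Variables (mu : {finite_measure set E -> \bar R}) (M K b : R).
Hypotheses (M0 : 0 <= M) (K0 : 0 <= K) (b0 : 0 < b).
Hypothesis domN : forall x A, measurable A -> (N x A <= M%:E * mu A + b%:E)%E.
Hypothesis excN : forall f : E -> \bar R, (forall x, (0 <= f x)%E) ->
  measurable_fun [set: E] f ->
  (\int[mu]_x \int[N x]_y f y <= K%:E * \int[mu]_x f x)%E.

Let muT : (mu [set: E] < +oo)%E.
Proof. by rewrite -ge0_fin_numE// fin_num_measure. Qed.

Let NT x : (N x [set: E] < +oo)%E.
Proof. by rewrite -ge0_fin_numE//; exact: fker_fin_num. Qed.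

Let bI u : bmeas u -> mu.-integrable [set: E] (EFin \o u).
Proof. exact: bmeas_integrable. Qed.

Let mcode n := @measurable_code d E G GE n.

(** [gen_resid n] and [mean_resid n] are the [D_n] and [N D_n] of the overview, on real
    functions. *)
Definition gen_resid n u := resid mu (generator_code G n) u.
Definition mean_resid n u := kernel_mean N (gen_resid n u).

Lemma bmeas_gen_resid n u : bmeas u -> bmeas (gen_resid n u).
Proof. by move=> bu; exact: (bmeas_resid _ (@mcode n)). Qed.

Lemma bmeas_mean_resid n u : bmeas u -> bmeas (mean_resid n u).
Proof. by move=> bu; apply: bmeas_kernel_mean; exact: bmeas_gen_resid. Qed.

Lemma gen_resid_le n u a x : bmeas u -> (forall x, `|u x| <= a) -> `|gen_resid n u x| <= 2 * a.
Proof. by move=> bu ua; exact: (resid_le _ (@mcode n)). Qed.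

Lemma mean_residB n u v x : bmeas u -> bmeas v ->
  mean_resid n (fun y => u y - v y) x = mean_resid n u x - mean_resid n v x.
Proof.
move=> bu bv; rewrite /mean_resid -kernel_meanB; [|exact: bmeas_gen_resid|exact: bmeas_gen_resid].
by congr kernel_mean; apply/funext => y; rewrite /gen_resid (residB _ (@mcode n)).
Qed.

Lemma mean_residZ n c u x : bmeas u -> mean_resid n (fun y => c * u y) x = c * mean_resid n u x.
Proof.
move=> bu; rewrite /mean_resid -kernel_meanZ; last exact: bmeas_gen_resid.
congr kernel_mean; apply/funext => y; rewrite /gen_resid /resid /avg mulrBr mulrA; congr (_ - _ * _).
by rewrite RintegralZl//; [exact: mcode|apply: integrableS (bI bu) => //; exact: mcode].
Qed.

(** Residuals at most double both the sup norm and the [L^1(mu)] norm; [dominated_Rintegral] does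
    the rest. This is how an [L^1(mu)] estimate returns to the sup norm. *)
Lemma mean_resid_le n u a x : bmeas u -> (forall x, `|u x| <= a) ->
  `|mean_resid n u x| <= 2 * M * \int[mu]_x `|u x| + 2 * b * a.
Proof.
move=> bu ua; have br := bmeas_gen_resid n bu.
have -> : mean_resid n u x = \int[as_finite (NT x)]_y gen_resid n u y by [].
rewrite (le_trans (@dominated_Rintegral _ _ _ (as_finite (NT x)) mu M b M0 (domN x)
  _ (2 * a) br _))//.
  by move=> y; exact: gen_resid_le.
have := Rintegral_norm_resid mu (@mcode n) bu.
by rewrite -/(gen_resid n u) => /(ler_wpM2l M0) h; lra.
Qed.

Lemma Rintegral_kernel_mean u : bmeas u -> \int[mu]_x `|kernel_mean N u x| <= K * \int[mu]_x `|u x|.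
Proof.
move=> bu; have bau := bmeas_norm bu.
have bN := bmeas_kernel_mean N bau.
rewrite (@le_trans _ _ (\int[mu]_x kernel_mean N (fun y => `|u y|) x))//.
  apply: le_Rintegral => //; [|exact: bI|].
  - by apply: bI; apply: bmeas_norm; exact: bmeas_kernel_mean.
  - by move=> x _; exact: le_norm_Rintegral.
rewrite -lee_fin EFinM -!bmeas_integralE//.
under eq_integral do rewrite -bmeas_integralE//.
apply: excN => [x|]; first by rewrite lee_fin.
by apply/measurable_EFinP; case: bau.
Qed.

Lemma Rintegral_mean_resid n u : bmeas u ->
  \int[mu]_x `|mean_resid n u x| <= 2 * K * \int[mu]_x `|u x|.
Proof.
move=> bu; rewrite (le_trans (Rintegral_kernel_mean (bmeas_gen_resid n bu)))//.
by have := ler_wpM2l K0 (Rintegral_norm_resid mu (@mcode n) bu); rewrite -/(gen_resid n u); lra.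
Qed.

(** The rank depends on [x], through the density of [N x], but not on [u]. The term [2 * b] is the
    mass of the part without density times the bound 2 on residuals. *)
Lemma mean_resid_eventually x e : 0 < e -> \forall n \near \oo, forall u, bmeas u ->
  (forall x, `|u x| <= 1) -> `|mean_resid n u x| <= 2 * b + e.
Proof.
move=> e0.
have [rho [g [rb gi rg]]] :=
  @dominated_density _ _ _ (as_finite (NT x)) mu M b M0 (domN x).
have := resid_cvg_integrable GE gi e0; apply: filterS => n hn u bu u1.
have br := bmeas_gen_resid n bu.
have -> : mean_resid n u x = \int[as_finite (NT x)]_y gen_resid n u y by [].
rewrite rg// (le_trans (ler_normD _ _))// lerD//; last exact: hn.
have rT : (rho [set: E] < +oo)%E by rewrite (le_lt_trans rb)// ltry.
rewrite (le_trans (@norm_Rintegral_le _ _ _ rho _ 2 rT br _))//.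
  by move=> y; rewrite -[2]mulr1; exact: gen_resid_le.
by rewrite ler_wpM2l// -lee_fin fineK// fin_num_measure.
Qed.

Lemma bmeas_clamp a u : bmeas u -> bmeas (fun x => clamp a (u x)).
Proof.
move=> bu; rewrite /clamp; under eq_fun do rewrite mulrC.
apply: bmeasZ; apply: bmeasB; apply: bmeas_norm; apply: bmeasD => //;
  exact: bmeas_cst.
Qed.

Lemma bmeas_dist_clamp a u : bmeas u -> bmeas (fun x => `|u x - clamp a (u x)|).
Proof. by move=> bu; apply: bmeas_norm; apply: bmeasB => //; exact: bmeas_clamp. Qed.

(* Arguing by contradiction with one function u n for each n avoids taking a
   supremum over u, which might not be measurable. *)
Lemma mean_resid_excess_small e : 0 < e -> exists n, forall u, bmeas u ->
  (forall x, `|u x| <= 1) ->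
  \int[mu]_x `|mean_resid n u x - clamp (2 * b) (mean_resid n u x)| <= e.
Proof.
move=> e0; apply: contrapT => hn.
have [C C1 NC] := fker_bound N.
have C0 : 0 <= C by rewrite (le_trans _ C1).
have b20 : 0 <= 2 * b by rewrite mulr_ge0// ltW.
have {hn}/choice[u hu] n : exists u : E -> R, [/\ bmeas u, forall x, `|u x| <= 1 &
    e < \int[mu]_x `|mean_resid n u x - clamp (2 * b) (mean_resid n u x)|].
  apply: contrapT => hu; apply: hn; exists n => u bu u1.
  by rewrite leNgt; apply/negP => h; apply: hu; exists u.
pose w n x := `|mean_resid n (u n) x - clamp (2 * b) (mean_resid n (u n) x)|.
have bw n : bmeas (w n).
  by apply: bmeas_dist_clamp; apply: bmeas_mean_resid; case: (hu n).
(* The estimate at [x] is uniform in [u], hence applies to the varying functions [u n]. *)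
have w0 x : (fun n => w n x) @ \oo --> 0.
  apply/cvgrPdist_le => e1 e10.
  apply: filterS (mean_resid_eventually x e10) => n hn.
  have [bu u1 _] := hu n.
  by rewrite sub0r normrN normr_id; apply: dist_clamp_le => //; [exact: ltW|exact: hn].
have wC n x : `|w n x| <= 2 * C.
  rewrite normr_id; have [bu u1 _] := hu n.
  apply: dist_clamp_le => //; first by rewrite mulr_ge0.
  rewrite (@le_trans _ _ (C * 2))//.
    apply: kernel_mean_le => //; first exact: bmeas_gen_resid.
    by move=> y; rewrite -[2]mulr1; exact: gen_resid_le.
  by rewrite mulrC lerDr.
have [|||||_ _] := @dominated_convergence _ _ _ mu _ measurableT
  (fun n x => (w n x)%:E) (cst 0%E) (cst (2 * C)%:E).
- by move=> n; apply/measurable_EFinP; case: (bw n).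
- exact: measurable_cst.
- by apply: aeW => x _; apply: cvg_EFin; [exact: nearW|exact: w0].
- exact: (bI (bmeas_cst E (2 * C))).
- by apply: aeW => x n _ /=; rewrite lee_fin.
rewrite integral0 => /fine_cvgP[_ /cvgrPdist_lt /(_ e e0)[n _ /(_ n (leqnn n))]].
rewrite /= sub0r normrN ltNge => /negP; apply.
have [_ _ h] := hu n.
by rewrite (le_trans (ltW h))// (le_trans _ (ler_norm _)).
Qed.

Section iteration.
Variables (n : nat) (e : R).
Hypotheses (e0 : 0 <= e)
  (he : forall u, bmeas u -> (forall x, `|u x| <= 1) ->
    \int[mu]_x `|mean_resid n u x - clamp (2 * b) (mean_resid n u x)| <= e).

(* Splitting u = clamp a u + r, the first part is dealt with by [he] after
   rescaling and the second one by boundedness on L^1(mu). *)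
Lemma mean_resid_excess_step u a xi : 0 < a -> bmeas u ->
  \int[mu]_x `|u x - clamp a (u x)| <= xi ->
  \int[mu]_x `|mean_resid n u x - clamp (a * (2 * b)) (mean_resid n u x)| <= 2 * K * xi + e * a.
Proof.
move=> a0 bu uxi.
pose v x := clamp a (u x); pose r x := u x - v x.
have bv : bmeas v by exact: bmeas_clamp.
have br : bmeas r by exact: bmeasB.
pose v1 x := a^-1 * v x.
have bv1 : bmeas v1 by exact: bmeasZ.
have v11 x : `|v1 x| <= 1.
  rewrite normrM normfV (gtr0_norm a0) mulrC ler_pdivrMr// mul1r.
  by apply: clamp_le; exact: ltW.
have uE x : mean_resid n u x = a * mean_resid n v1 x + mean_resid n r x.
  rewrite -mean_residZ//.
  have -> : (fun y => a * v1 y) = v.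
    by apply/funext => y; rewrite /v1 mulrA divff ?gt_eqF// mul1r.
  by rewrite /r mean_residB// addrC subrK.
have ab0 : 0 <= a * (2 * b) by rewrite !mulr_ge0// ltW.
have bN1 := bmeas_mean_resid n bv1; have bNr := bmeas_norm (bmeas_mean_resid n br).
have bc := bmeas_dist_clamp (2 * b) bN1.
rewrite (@le_trans _ _ (\int[mu]_x (`|mean_resid n r x| +
    a * `|mean_resid n v1 x - clamp (2 * b) (mean_resid n v1 x)|)))//.
  apply: le_Rintegral => //.
  - by apply: bI; apply: bmeas_dist_clamp; exact: bmeas_mean_resid.
  - by apply: bI; apply: bmeasD => //; exact: bmeasZ.
  - move=> x _; rewrite uE (le_trans (dist_clampD _ _ _))//.
    by rewrite addrC lerD// dist_clampM// ltW.
rewrite RintegralD//; [|exact: bI|by apply: bI; exact: bmeasZ].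
rewrite RintegralZl//; last exact: bI.
rewrite lerD//; last by rewrite mulrC ler_wpM2r ?(ltW a0)//; exact: he.
by rewrite (le_trans (Rintegral_mean_resid n br))// ler_wpM2l// mulr_ge0.
Qed.

Lemma bmeas_iter_mean_resid l u : bmeas u -> bmeas (iter l (mean_resid n) u).
Proof. by move=> bu; elim: l => //= l IH; exact: bmeas_mean_resid. Qed.

(** A step turns a bound [xi] into [2 * K * xi + e * (2 * b) ^+ l], starting from 0 because
    [|u| <= 1]; the base [1 + 2 * K + 2 * b] is large enough to absorb the second term. *)
Lemma iter_mean_resid_excess l u : bmeas u -> (forall x, `|u x| <= 1) ->
  \int[mu]_x `|iter l (mean_resid n) u x - clamp ((2 * b) ^+ l) (iter l (mean_resid n) u x)|
    <= e * (1 + 2 * K + 2 * b) ^+ l.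
Proof.
move=> bu u1; elim: l => [|l IH].
  rewrite !expr0 mulr1; under eq_Rintegral => x _.
    have -> : `|iter 0 (mean_resid n) u x - clamp 1 (iter 0 (mean_resid n) u x)| = 0.
      apply/eqP; rewrite eq_le normr_ge0 andbT; apply: dist_clamp_le => //.
      by rewrite addr0; exact: u1.
    over.
  by rewrite Rintegral_cst// mul0r.
have b20 : 0 < 2 * b by rewrite mulr_gt0.
have := mean_resid_excess_step (exprn_gt0 l b20) (bmeas_iter_mean_resid l bu) IH.
rewrite -exprSr; move/le_trans; apply.
rewrite mulrCA -mulrDr ler_wpM2l// exprS.
have h : (2 * b) ^+ l <= (1 + 2 * K + 2 * b) ^+ l.
  by rewrite lerXn2r ?nnegrE ?addr_ge0 ?mulr_ge0 ?(ltW b0)// lerDr addr_ge0// mulr_ge0.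
have h2 : 0 <= (2 * b) * (1 + 2 * K + 2 * b) ^+ l.
  by rewrite !mulr_ge0 ?exprn_ge0 ?addr_ge0 ?mulr_ge0// ltW.
by lra.
Qed.

(** Truncating at [(2 * b) ^+ l] bounds the [L^1(mu)] norm of the [l]-th iterate by
    [(mu E + 1) * (2 * b) ^+ l]. With the condition on [L], the integral term of [mean_resid_le] is
    then at most [2 * b * L * (4 * b) ^+ l], as is the sup term, hence the ratio [4 * b]. *)
Lemma iter_mean_resid_le L l u : bmeas u -> (forall x, `|u x| <= 1) ->
  1 <= L -> M * (fine (mu [set: E]) + 1) <= b * L ->
  (forall k, (k < l)%N -> e * (1 + 2 * K + 2 * b) ^+ k <= (2 * b) ^+ k) ->
  forall x, `|iter l (mean_resid n) u x| <= L * (4 * b) ^+ l.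
Proof.
move=> bu u1 L1 hL; elim: l => [|l IH] el x; first by rewrite expr0 mulr1 (le_trans (u1 x)).
have {}IH := IH (fun k kl => el k (ltnW kl)).
have b0' := b0; have b20 : 0 <= 2 * b by lra.
have bg := bmeas_iter_mean_resid l bu.
rewrite [iter l.+1 _]/= (le_trans (mean_resid_le n x bg IH))//.
set g := iter l (mean_resid n) u in bg *.
have g1 : \int[mu]_y `|g y| <= (fine (mu [set: E]) + 1) * (2 * b) ^+ l.
  have bc := bmeas_clamp ((2 * b) ^+ l) bg.
  rewrite (@le_trans _ _ (\int[mu]_y (`|clamp ((2 * b) ^+ l) (g y)| +
    `|g y - clamp ((2 * b) ^+ l) (g y)|)))//.
    apply: le_Rintegral => //.
    - by apply: bI; exact: bmeas_norm.
    - apply: bI; apply: bmeasD; first exact: bmeas_norm.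
      exact: bmeas_dist_clamp.
    - by move=> y _; rewrite (le_trans _ (ler_normD _ _))// addrC subrK.
  rewrite RintegralD//; [|by apply: bI; exact: bmeas_norm|
    by apply: bI; exact: bmeas_dist_clamp].
  rewrite (mulrDl (fine _)) mul1r lerD//.
    rewrite [leRHS]mulrC; apply: Rintegral_norm_le => //.
    by move=> y; apply: clamp_le; rewrite exprn_ge0.
  by rewrite (le_trans (iter_mean_resid_excess l bu u1))// el.
have h : (2 * b) ^+ l <= (4 * b) ^+ l by rewrite lerXn2r ?nnegrE//; lra.
have m0 : 0 <= fine (mu [set: E]) + 1 by rewrite addr_ge0// fine_ge0.
have h2 : M * \int[mu]_y `|g y| <= b * L * (4 * b) ^+ l.
  rewrite (@le_trans _ _ (M * ((fine (mu [set: E]) + 1) * (2 * b) ^+ l)))//.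
    by rewrite ler_wpM2l.
  rewrite mulrA ler_pM// ?exprn_ge0// mulr_ge0//.
rewrite exprS; lra.
Qed.

End iteration.

Lemma exists_iter_mean_resid_le : exists2 L, 0 <= L & forall l, exists n, forall u, bmeas u ->
  (forall x, `|u x| <= 1) -> forall x, `|iter l (mean_resid n) u x| <= L * (4 * b) ^+ l.
Proof.
exists (1 + M * (fine (mu [set: E]) + 1) / b).
  by rewrite addr_ge0// divr_ge0 ?mulr_ge0 ?addr_ge0 ?fine_ge0// ltW.
move=> l.
pose Q := 1 + 2 * K + 2 * b.
have Q1 : 1 <= Q by rewrite /Q -addrA lerDl addr_ge0 ?mulr_ge0// ltW.
have Q0 : 0 < Q by rewrite (lt_le_trans _ Q1).
(* For [e = (c / Q) ^+ l] and [k < l], [e * Q ^+ k = (c / Q) ^+ (l - k) * c ^+ k]: the first factor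
   is at most 1 as [c <= 1 <= Q], the second at most [(2 * b) ^+ k]. *)
pose c := Num.min 1 (2 * b).
have c0 : 0 < c by rewrite lt_min ltr01 mulr_gt0.
have c1 : c <= 1 by rewrite ge_min lexx.
have c2 : c <= 2 * b by rewrite ge_min lexx orbT.
have e0 : 0 < (c / Q) ^+ l by rewrite exprn_gt0// divr_gt0.
have [n hn] := mean_resid_excess_small e0.
exists n => u bu u1 x; apply: (iter_mean_resid_le (ltW e0) hn) => //.
- by rewrite lerDl divr_ge0 ?mulr_ge0 ?addr_ge0 ?fine_ge0// ltW.
- set A := M * _; have -> : b * (1 + A / b) = b + A by field; rewrite gt_eqF.
  by rewrite lerDr ltW.
move=> k kl; rewrite -/Q -(subnK (ltnW kl)) exprD -mulrA -exprMn divfK ?gt_eqF//.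
rewrite -[leRHS]mul1r; apply: ler_pM.
- by rewrite exprn_ge0// divr_ge0// ltW.
- by rewrite exprn_ge0// ltW.
- by rewrite exprn_ile1// ?divr_ge0 ?(ltW c0) ?(ltW Q0)// ler_pdivrMr// mul1r (le_trans c1).
- by rewrite lerXn2r ?nnegrE// ?(ltW c0)// (le_trans (ltW c0)).
Qed.

End residual_iterates.

(** * Kernels as operators on L^oo(V) *)

Section sigma_finite_copy.
Context d (E : measurableType d) (R : realType).

Definition as_sigma_finite (m : {measure set E -> \bar R})
  (sm : sigma_finite [set: E] m) : set E -> \bar R := m.

HB.instance Definition _ m sm := Measure.copy (@as_sigma_finite m sm) m.

HB.instance Definition _ m sm :=
  Measure_isSigmaFinite.Build _ _ _ (@as_sigma_finite m sm) sm.

End sigma_finite_copy.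

Section kernel_normalization.
Context d (E : measurableType d) (R : realType) (V : weight E R).
Variables (k : R.-sigmafker E ~> E) (kV : kernel_to_Linfty V k).

Let V0 x : 0 <= V x. Proof. by rewrite ltW// weight_gt0. Qed.

Let iV0 x : 0 <= (V x)^-1. Proof. by rewrite invr_ge0. Qed.

Let mV : measurable_fun [set: E] (fun y => (V y)%:E).
Proof. by apply/measurable_EFinP; exact: measurable_weight. Qed.

(* [N(x, dy) = V(y) k(x, dy) / V(x)], so that the operator of [k] on
   [L^oo(V)] becomes the one of [N] on bounded functions *)
Definition normalized_measure (_ : kernel_to_Linfty V k) (x : E) (A : set E) : \bar R :=
  (((V x)^-1)%:E * \int[k x]_(y in A) (V y)%:E)%E.

Let normalized_measure0 x : normalized_measure kV x set0 = 0%E.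
Proof. by rewrite /normalized_measure integral_set0 mule0. Qed.

Let normalized_measure_ge0 x A : (0 <= normalized_measure kV x A)%E.
Proof.
by rewrite mule_ge0 ?lee_fin// integral_ge0// => y _; rewrite lee_fin.
Qed.

Let normalized_measure_sigma_additive x : semi_sigma_additive (normalized_measure kV x).
Proof.
move=> F mF tF mUF; rewrite /normalized_measure ge0_integral_bigcup//; last 2 first.
- exact: measurable_funTS.
- by move=> y _; rewrite lee_fin.
rewrite -nneseriesZl; last first.
  by move=> i _; apply: integral_ge0 => y _; rewrite lee_fin.
apply: is_cvg_ereal_nneg_natsum => i _.
exact: normalized_measure_ge0.
Qed.

HB.instance Definition _ x := isMeasure.Build _ _ _ (normalized_measure kV x) (normalized_measure0 x)
  (normalized_measure_ge0 x) (@normalized_measure_sigma_additive x).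

Definition normalized_kernel (x : E) : {measure set E -> \bar R} := normalized_measure kV x.

Let measurable_iV : measurable_fun [set: E] (fun x => (V x)^-1).
Proof.
have -> : (fun x => (V x)^-1) = (fun x => expR (- ln (V x))).
  by apply/funext => x; rewrite expRN lnK// posrE weight_gt0.
apply: measurableT_comp => //; apply: measurableT_comp => //.
by apply: measurableT_comp => //; exact: measurable_weight.
Qed.

Let measurable_normalized_kernel A : measurable A -> measurable_fun [set: E] (normalized_kernel ^~ A).
Proof.
move=> mA; apply: emeasurable_funM; first exact/measurable_EFinP.
have -> : (fun x => \int[k x]_(y in A) (V y)%:E)%E =
    (fun x => \int[k x]_y (V y * \1_A y)%:E)%E.
  apply/funext => x; rewrite integral_mkcond; apply: eq_integral => y _.
  by rewrite patchE indicE; case: ifPn; rewrite ?mulr1 ?mulr0.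
apply: measurable_fun_integral_kernel.
- exact: measurable_kernel.
- by move=> y; rewrite lee_fin mulr_ge0// indicE ler0n.
- apply/measurable_EFinP; apply: measurable_funM; first exact: measurable_weight.
  exact: measurable_indic.
Qed.

HB.instance Definition _ := isKernel.Build _ _ _ _ _ normalized_kernel measurable_normalized_kernel.

Let normalized_kernel_uub : measure_fam_uub normalized_kernel.
Proof.
have [M M0 kM] := kernel_bound kV; exists (M + 1) => x.
rewrite (@le_lt_trans _ _ M%:E)//; last by rewrite lte_fin ltrDl.
rewrite /normalized_kernel/= /normalized_measure muleC lee_pdivrMr ?weight_gt0// -EFinM.
Qed.

HB.instance Definition _ := Kernel_isFinite.Build _ _ _ _ _ normalized_kernel normalized_kernel_uub.

(** The function [V y / V x] of [y] is a density of the normalized measure with respect to [k x],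
    hence almost everywhere its Radon-Nikodym derivative, whose change of variables applies to a
    signed [u]. *)
Lemma Rintegral_normalized_kernel u x : bmeas u ->
  \int[normalized_kernel x]_y u y = (V x)^-1 * \int[k x]_y (u y * V y).
Proof.
move=> bu.
have nT : (normalized_kernel x [set: E] < +oo)%E.
  by rewrite -ge0_fin_numE//; exact: (fker_fin_num normalized_kernel).
pose nu : {finite_measure set E -> \bar R} := as_finite nT.
pose mu : {sigma_finite_measure set E -> \bar R} :=
  as_sigma_finite (kernel_sigma_finite (s := k) x).
have gi : mu.-integrable [set: E] (fun y => ((V x)^-1 * V y)%:E).
  under eq_fun do rewrite EFinM.
  by apply: integrableZl => //; exact: (integrable_V kV x).
have nuE A : measurable A -> nu A = (\int[mu]_(y in A) ((V x)^-1 * V y)%:E)%E.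
  move=> mA; under eq_integral do rewrite EFinM.
  rewrite ge0_integralZl ?lee_fin//.
  - exact: measurable_funTS.
  - by move=> y _; rewrite lee_fin.
have dom : charge_of_finite_measure nu `<< mu.
  apply/null_content_dominatesP => A mA muA0; rewrite [LHS]nuE//.
  apply: null_set_integral => //; apply: measurable_funTS.
  exact: measurable_int gi.
have nui : nu.-integrable [set: E] (EFin \o u) by exact: bmeas_integrable.
have aeq : ae_eq mu [set: E] (Radon_Nikodym (charge_of_finite_measure nu) mu)
    (fun y => ((V x)^-1 * V y)%:E).
  apply: integral_ae_eq => //.
  - exact: Radon_Nikodym_integrable.
  - exact: measurable_int gi.
  - by move=> A _ mA; rewrite -Radon_Nikodym_integral// [LHS]nuE.
have uV : mu.-integrable [set: E] (EFin \o (fun y => u y * V y)).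
  have [mu_ [C uC]] := bu.
  apply: (integrable_Linfty kV (C := C)).
    by apply: measurable_funM => //; exact: measurable_weight.
  by move=> y; rewrite normrM (ger0_norm (V0 y)) ler_wpM2r.
have -> : \int[normalized_kernel x]_y u y = fine (\int[nu]_y (u y)%:E)%E by [].
rewrite -(Radon_Nikodym_change_of_variables dom measurableT nui).
rewrite -(RintegralZl _ measurableT uV) /Rintegral; congr fine.
apply: ae_eq_integral => //.
- apply: emeasurable_funM; first exact: measurable_int nui.
  by apply: measurable_int; exact: Radon_Nikodym_integrable.
- apply/measurable_EFinP; apply: measurable_funM => //.
  by apply/measurable_EFinP; exact: measurable_int uV.
- apply: filterS aeq => y /= h _; rewrite h// -EFinM; congr (_%:E).
  by rewrite mulrCA.
Qed.

End kernel_normalization.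

(** * Elements of L^oo(V) as pairs of bounded real functions *)

Section lifting.
Local Open Scope complex_scope.
Context d (E : measurableType d) (R : realType) (V : weight E R).
Implicit Types (f g : Linfty V) (u v : E -> R).

Let V0 x : 0 < V x. Proof. exact: weight_gt0. Qed.

Definition rpart f y : R := complex.Re (f y) / V y.
Definition ipart f y : R := complex.Im (f y) / V y.

Let measurable_divV u : measurable_fun [set: E] u ->
  measurable_fun [set: E] (fun y => u y / V y).
Proof.
move=> mu; apply: measurable_funM => //.
have -> : (fun x => (V x)^-1) = (fun x => expR (- ln (V x))).
  by apply/funext => x; rewrite expRN lnK// posrE.
apply: measurableT_comp => //; apply: measurableT_comp => //.
by apply: measurableT_comp => //; exact: measurable_weight.
Qed.

Lemma rpart_le f y : `|rpart f y| <= nrm f.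
Proof.
rewrite normrM normfV (gtr0_norm (V0 y)) ler_pdivrMr//.
exact: le_trans (normc_ge_absRe _) (le_Vnorm _ _).
Qed.

Lemma ipart_le f y : `|ipart f y| <= nrm f.
Proof.
rewrite normrM normfV (gtr0_norm (V0 y)) ler_pdivrMr//.
exact: le_trans (normc_ge_absIm _) (le_Vnorm _ _).
Qed.

Lemma bmeas_rpart f : bmeas (rpart f).
Proof.
have /asboolP[/cmeasurableP[mR _] _] := Linfty_funP f.
by split; [exact: measurable_divV|exists (nrm f) => y; exact: rpart_le].
Qed.

Lemma bmeas_ipart f : bmeas (ipart f).
Proof.
have /asboolP[/cmeasurableP[_ mI] _] := Linfty_funP f.
by split; [exact: measurable_divV|exists (nrm f) => y; exact: ipart_le].
Qed.

Lemma Linfty_ext f g : rpart f =1 rpart g -> ipart f =1 ipart g -> f = g.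
Proof.
move=> fgR fgI; apply: val_inj; apply/funext => y /=.
have VV : V y != 0 by rewrite gt_eqF.
have := fgR y; have := fgI y; rewrite /rpart /ipart.
case: (f y) (g y) => a b [a' b'] /=.
by move=> /(mulIf (invr_neq0 VV)) -> /(mulIf (invr_neq0 VV)) ->.
Qed.

Lemma nrm_le_parts f a b : (forall y, `|rpart f y| <= a) ->
  (forall y, `|ipart f y| <= b) -> nrm f <= a + b.
Proof.
move=> fa fb; apply: Vnorm_le => y; rewrite (le_trans (normc_le_absD _))//.
have := fa y; have := fb y; rewrite !normrM normfV (gtr0_norm (V0 y)).
by rewrite !ler_pdivrMr// mulrDl => h1 h2; rewrite lerD.
Qed.

Lemma of_parts_Linfty u v : bmeas u -> bmeas v ->
  (fun x => (V x * u x) +i* (V x * v x)) \in Linfty_pred V.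
Proof.
move=> [mu [a ua]] [mv [b vb]]; have mV := measurable_weight V.
apply/asboolP; split.
  by apply/cmeasurableP; split; exact: measurable_funM.
have a0 : 0 <= a by exact: le_trans (ua point).
have b0 : 0 <= b by exact: le_trans (vb point).
exists (a + b + 1) => [|x]; first by rewrite ltr_wpDl// addr_ge0.
rewrite (le_trans (normc_le_absD _))//= !normrM !(gtr0_norm (V0 x)) -mulrDr mulrC.
rewrite ler_wpM2r ?(ltW (V0 x))// ler_wpDr// lerD//.
Qed.

Definition of_parts u v (bu : bmeas u) (bv : bmeas v) : Linfty V :=
  MkLinfty (of_parts_Linfty bu bv).

Lemma rpart_of_parts u v (bu : bmeas u) (bv : bmeas v) : rpart (of_parts bu bv) = u.
Proof. by apply/funext => x; rewrite /rpart/= mulrC mulKf// gt_eqF. Qed.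

Lemma ipart_of_parts u v (bu : bmeas u) (bv : bmeas v) : ipart (of_parts bu bv) = v.
Proof. by apply/funext => x; rewrite /ipart/= mulrC mulKf// gt_eqF. Qed.

Lemma rpartZD (a : R[i]) f g :
  rpart (a *: f + g) = fun y => complex.Re a * rpart f y +
    (- complex.Im a * ipart f y + rpart g y).
Proof.
apply/funext => y; rewrite /rpart /ipart /= !fctE /GRing.scale/=.
case: a (f y) (g y) => ? ? [? ?] [? ?] /=; ring.
Qed.

Lemma ipartZD (a : R[i]) f g :
  ipart (a *: f + g) = fun y => complex.Re a * ipart f y +
    (complex.Im a * rpart f y + ipart g y).
Proof.
apply/funext => y; rewrite /rpart /ipart /= !fctE /GRing.scale/=.
case: a (f y) (g y) => ? ? [? ?] [? ?] /=; ring.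
Qed.

Lemma rpartD f g : rpart (f + g) = fun y => rpart f y + rpart g y.
Proof.
by apply/funext => y; rewrite -[f]scale1r rpartZD/= scale1r oppr0 mul0r add0r mul1r.
Qed.

Lemma ipartD f g : ipart (f + g) = fun y => ipart f y + ipart g y.
Proof.
by apply/funext => y; rewrite -[f]scale1r ipartZD/= scale1r mul0r add0r mul1r.
Qed.

Lemma rpart0 : rpart (0 : Linfty V) = fun=> 0.
Proof.
apply/funext => y; rewrite /rpart; have -> : (0 : Linfty V) y = 0 by [].
by rewrite mul0r.
Qed.

Lemma ipart0 : ipart (0 : Linfty V) = fun=> 0.
Proof.
apply/funext => y; rewrite /ipart; have -> : (0 : Linfty V) y = 0 by [].
by rewrite mul0r.
Qed.

Lemma rpartZr (r : R) f : rpart (r%:C *: f) = fun y => r * rpart f y.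
Proof.
by apply/funext => y; rewrite -[_ *: f]addr0 rpartZD/= rpart0 oppr0 mul0r !addr0.
Qed.

Lemma ipartZr (r : R) f : ipart (r%:C *: f) = fun y => r * ipart f y.
Proof.
by apply/funext => y; rewrite -[_ *: f]addr0 ipartZD/= ipart0 mul0r !addr0.
Qed.

Lemma rpartN f : rpart (- f) = fun y => - rpart f y.
Proof.
apply/funext => y; rewrite /rpart; have -> : (- f) y = - f y by [].
by case: (f y) => a b /=; rewrite mulNr.
Qed.

Lemma ipartN f : ipart (- f) = fun y => - ipart f y.
Proof.
apply/funext => y; rewrite /ipart; have -> : (- f) y = - f y by [].
by case: (f y) => a b /=; rewrite mulNr.
Qed.

(** Operators on bounded measurable real functions, written as maps on all functions whose laws are
    only imposed on the bounded measurable ones. Kernels and conditional expectations both take this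
    form. *)
Record blinear := BLinear {
  blinear_fun :> (E -> R) -> E -> R;
  blinear_bmeas : forall u, bmeas u -> bmeas (blinear_fun u);
  blinear_lin : forall a u v x, bmeas u -> bmeas v ->
    blinear_fun (fun y => a * u y + v y) x = a * blinear_fun u x + blinear_fun v x }.

Implicit Types U W : blinear.

Definition lift_parts U f : Linfty V :=
  of_parts (blinear_bmeas U (bmeas_rpart f)) (blinear_bmeas U (bmeas_ipart f)).

Lemma rpart_lift U f : rpart (lift_parts U f) = U (rpart f).
Proof. exact: rpart_of_parts. Qed.

Lemma ipart_lift U f : ipart (lift_parts U f) = U (ipart f).
Proof. exact: ipart_of_parts. Qed.

(** A complex scalar mixes the two parts with real coefficients, which the real-linear [U] respects
    because it acts in the same way on both. *)
Lemma lift_is_linear U : linear (lift_parts U).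
Proof.
move=> a f g.
have bZD c w z : bmeas w -> bmeas z -> bmeas (fun y => c * w y + z y).
  by move=> bw bz; apply: bmeasD => //; exact: bmeasZ.
have br := bmeas_rpart; have bi := bmeas_ipart.
apply: Linfty_ext => y.
  rewrite rpart_lift !rpartZD rpart_lift ipart_lift rpart_lift.
  by rewrite blinear_lin//; [rewrite blinear_lin|exact: bZD].
rewrite ipart_lift !ipartZD rpart_lift !ipart_lift.
by rewrite blinear_lin//; [rewrite blinear_lin|exact: bZD].
Qed.

HB.instance Definition _ U :=
  GRing.isLinear.Build R[i] (Linfty V) (Linfty V) _ (lift_parts U) (lift_is_linear U).

Definition bounded_blinear U C := forall u a, bmeas u -> (forall x, `|u x| <= a) ->
  forall x, `|U u x| <= C * a.

Lemma lift_bounded U C : bounded_blinear U C -> bounded_by (lift_parts U) (2 * C).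
Proof.
move=> UC f; rewrite -mulrA mulr_natl mulr2n; apply: nrm_le_parts => y.
  by rewrite rpart_lift; apply: UC; [exact: bmeas_rpart|exact: rpart_le].
by rewrite ipart_lift; apply: UC; [exact: bmeas_ipart|exact: ipart_le].
Qed.

Lemma rpart_iter_lift U n f : rpart (iter n (lift_parts U) f) = iter n U (rpart f).
Proof. by elim: n => //= n <-; rewrite rpart_lift. Qed.

Lemma ipart_iter_lift U n f : ipart (iter n (lift_parts U) f) = iter n U (ipart f).
Proof. by elim: n => //= n <-; rewrite ipart_lift. Qed.

End lifting.

Section kernel_lift.
Context d (E : measurableType d) (R : realType) (V : weight E R).

Lemma kernel_mean_is_blinear (N : R.-fker E ~> E) a u v x : bmeas u -> bmeas v ->
  kernel_mean N (fun y => a * u y + v y) x = a * kernel_mean N u x + kernel_mean N v x.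
Proof.
move=> bu bv.
have NT : (N x [set: E] < +oo)%E by rewrite -ge0_fin_numE//; exact: fker_fin_num.
rewrite /kernel_mean RintegralD// ?RintegralZl//; apply: bmeas_integrable => //.
exact: bmeasZ.
Qed.

Definition kernel_mean_blinear N := BLinear (@bmeas_kernel_mean _ _ _ N) (@kernel_mean_is_blinear N).

Lemma kernel_mean_blinear_bounded N : exists2 C, 0 <= C & bounded_blinear (kernel_mean_blinear N) C.
Proof.
have [C C1 NC] := fker_bound N; exists C; first by rewrite (le_trans _ C1).
by move=> u a bu ua x; exact: kernel_mean_le.
Qed.

Lemma kop_lift (k : R.-sigmafker E ~> E) (kV : kernel_to_Linfty V k) (f : Linfty V) :
  kop kV f = lift_parts (kernel_mean_blinear (normalized_kernel kV)) f.
Proof.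
apply: Linfty_ext => x.
  rewrite rpart_lift /= /kernel_mean Rintegral_normalized_kernel; last exact: bmeas_rpart.
  rewrite /rpart/= mulrC; congr (_ * _); apply: eq_Rintegral => y _.
  by rewrite divfK// gt_eqF// weight_gt0.
rewrite ipart_lift /= /kernel_mean Rintegral_normalized_kernel; last exact: bmeas_ipart.
rewrite /ipart/= mulrC; congr (_ * _); apply: eq_Rintegral => y _.
by rewrite divfK// gt_eqF// weight_gt0.
Qed.

(** The composition formula for kernels holds on nonnegative functions; [bmeas_ind] extends it by
    differences. *)
Lemma kernel_mean_kpow (N : R.-fker E ~> E) n u : bmeas u ->
  kernel_mean (kpow N n) u = iter n.+1 (kernel_mean N) u.
Proof.
elim: n u => // n IH u bu.
rewrite iterSr -IH; last exact: bmeas_kernel_mean.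
apply/funext => x; move: u bu.
apply: (@bmeas_ind _ _ _ (fun u => kernel_mean (kpow N n.+1) u x)
  (fun u => kernel_mean (kpow N n) (kernel_mean N u) x)).
- by move=> u v bu bv; rewrite kernel_meanB.
- move=> u v bu bv; rewrite -kernel_meanB; [|exact: bmeas_kernel_mean|exact: bmeas_kernel_mean].
  by congr kernel_mean; apply/funext => y; rewrite kernel_meanB.
move=> u bu u0; rewrite /kernel_mean /Rintegral integral_kpowS//; last first.
- by apply/measurable_EFinP; case: bu.
congr fine; apply: eq_integral => y _; rewrite bmeas_integralE//.
by rewrite -ge0_fin_numE//; exact: fker_fin_num.
Qed.

End kernel_lift.

Section real_scaling.
Local Open Scope complex_scope.
Context {R : realType} {B : normedModType R[i]}.

Lemma nrmZr (a : R) (f : B) : nrm (a%:C *: f) = `|a| * nrm f.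
Proof.
have [a0|a0] := leP 0 a; first by rewrite nrmZ// ger0_norm.
rewrite ltr0_norm// -nrmZ ?oppr_ge0 ?(ltW a0)//.
by rewrite rmorphN/= scaleNr nrmN.
Qed.

Lemma scale_real_continuous (f : B) : continuous (fun r : R => r%:C *: f).
Proof.
move=> r; apply/cvgrPdist_lt => e e0.
have eE : e = (complex.Re e)%:C by rewrite RRe_real// gtr0_real.
have d0 : 0 < complex.Re e / (nrm f + 1).
  by rewrite divr_gt0 ?ltr_wpDl ?nrm_ge0// -ltcR -eE.
exists (complex.Re e / (nrm f + 1)) => //= s; rewrite /ball_/= => rs.
rewrite -scalerBl -rmorphB/= nrmE eE ltcR nrmZr.
rewrite (@le_lt_trans _ _ (`|r - s| * (nrm f + 1)))//.
  by rewrite ler_wpM2l// lerDl.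
by rewrite -ltr_pdivlMr// ltr_wpDl// nrm_ge0.
Qed.

Lemma compact_segment (f : B) (C : R) :
  compact [set r%:C *: f | r in [set r : R | `|r| <= C]].
Proof.
apply: continuous_compact.
  by apply: continuous_subspaceT; exact: scale_real_continuous.
have -> : [set r : R | `|r| <= C] = `[- C, C]%classic.
  by apply/seteqP; split => r /=; rewrite in_itv/= ler_norml.
exact: segment_compact.
Qed.

Lemma opnorm_le_ball (T : B -> B) M : (forall f, nrm f <= 1 -> nrm (T f) <= M) ->
  opnorm T <= M.
Proof.
move=> TM; apply: ge_sup; first by exists (nrm (T 0)), 0 => //=; rewrite normr0.
by rewrite nball1E => _ [f f1 <-]; exact: TM.
Qed.

End real_scaling.

(** * Compactness of finite rank operators *)

Section finite_rank.
Local Open Scope complex_scope.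
Context d (E : measurableType d) (R : realType) (V : weight E R).
Variables (T : eqType) (al : T -> (E -> R) -> R) (e : T -> E -> R) (C : R).
Hypotheses (be : forall t, bmeas (e t))
  (al_lin : forall t a u v, bmeas u -> bmeas v ->
    al t (fun y => a * u y + v y) = a * al t u + al t v)
  (al_le : forall t u, bmeas u -> (forall x, `|u x| <= 1) -> `|al t u| <= C).

Definition finrank (s : seq T) u (x : E) := \sum_(t <- s) al t u * e t x.

Lemma bmeas_finrank s u : bmeas u -> bmeas (finrank s u).
Proof. by move=> bu; apply: bmeas_sum => t; exact: bmeasZ. Qed.

Lemma finrank_lin s a u v x : bmeas u -> bmeas v ->
  finrank s (fun y => a * u y + v y) x = a * finrank s u x + finrank s v x.
Proof.
move=> bu bv; rewrite /finrank mulr_sumr -big_split/=; apply: eq_bigr => t _.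
by rewrite al_lin// mulrDl mulrA.
Qed.

Definition finrank_blinear s := BLinear (@bmeas_finrank s) (@finrank_lin s).

(** The image of the unit ball lies in a finite sum of compact segments, two for each [t]: along
    [V * e t] and along its product by [i], with coefficients in [[-C, C]]. *)
Lemma compact_finrank s : compact_operator (lift_parts (V := V) (finrank_blinear s)).
Proof.
elim: s => [|t s IH].
  apply: (eq_compact_operator _ compact_operator0) => f /=.
  apply: Linfty_ext => x; [rewrite rpart_lift rpart0|rewrite ipart_lift ipart0];
    by rewrite /= /finrank big_nil.
have b0 := bmeas_cst E (0 : R).
pose e1 : Linfty V := of_parts V (be t) b0.
pose e2 : Linfty V := of_parts V b0 (be t).
have /compact_operatorP[K cK hK] := IH.
apply/compact_operatorP.
exists [set f.1 + f.2 | f in [set f.1 + f.2 | f in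
   [set r%:C *: e1 | r in [set r : R | `|r| <= C]] `*`
   [set r%:C *: e2 | r in [set r : R | `|r| <= C]]] `*` K].
  apply: continuous_compact.
    by apply: continuous_subspaceT; exact: add_continuous.
  apply: compact_setX => //; apply: continuous_compact.
    by apply: continuous_subspaceT; exact: add_continuous.
  by apply: compact_setX; exact: compact_segment.
move=> f f1; have br := bmeas_rpart f; have bi := bmeas_ipart f.
exists ((al t (rpart f))%:C *: e1 + (al t (ipart f))%:C *: e2,
  lift_parts (finrank_blinear s) f); last first.
  apply: Linfty_ext => x /=.
    rewrite !rpartD !rpartZr !rpart_of_parts/=.
    by rewrite /finrank big_cons mulr0 addr0.
  rewrite !ipartD !ipartZr !ipart_of_parts/=.
  by rewrite /finrank big_cons mulr0 add0r.
split=> /=; last exact: hK.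
exists ((al t (rpart f))%:C *: e1, (al t (ipart f))%:C *: e2) => //.
split=> /=.
  by exists (al t (rpart f)) => //=; apply: al_le => // x; exact: le_trans (rpart_le _ _) f1.
by exists (al t (ipart f)) => //=; apply: al_le => // x; exact: le_trans (ipart_le _ _) f1.
Qed.

End finite_rank.

Section average_operator.
Context d (E : measurableType d) (R : realType) (V : weight E R).
Variables (mu : {finite_measure set E -> \bar R}) (T : finType) (c : E -> T).
Hypothesis mc : forall t, measurable (c @^-1` [set t]).

Let muT : (mu [set: E] < +oo)%E.
Proof. by rewrite -ge0_fin_numE// fin_num_measure. Qed.

Definition cell_avg (t : T) (u : E -> R) : R :=
  (\int[mu]_(y in c @^-1` [set t]) u y) / fine (mu (c @^-1` [set t])).

Lemma cell_avg_lin t a u v : bmeas u -> bmeas v ->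
  cell_avg t (fun y => a * u y + v y) = a * cell_avg t u + cell_avg t v.
Proof.
move=> bu bv.
have cI w : bmeas w -> mu.-integrable (c @^-1` [set t]) (EFin \o w).
  by move=> bw; apply: (integrableS measurableT) => //; exact: bmeas_integrable.
have bZ : bmeas (fun y => a * u y) by exact: bmeasZ.
rewrite /cell_avg RintegralD//; [|exact: cI|exact: cI].
by rewrite RintegralZl//; [rewrite mulrDl mulrA|exact: cI].
Qed.

Lemma cell_avg_le t u : bmeas u -> (forall x, `|u x| <= 1) -> `|cell_avg t u| <= 1.
Proof.
move=> bu u1; have m0 : 0 <= fine (mu (c @^-1` [set t])) by exact: fine_ge0.
have := le_cell_Rintegral mu mc t bu u1.
rewrite mul1r /cell_avg normrM normfV (ger0_norm m0) => h.
have [->|mn0] := eqVneq (fine (mu (c @^-1` [set t]))) 0; first by rewrite invr0 mulr0.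
by rewrite ler_pdivrMr ?mul1r// lt_neqAle eq_sym mn0.
Qed.

Definition avg_blinear : blinear E R :=
  finrank_blinear (fun t => bmeas_indic R (mc t)) cell_avg_lin (enum T).

Lemma avg_blinearE u : avg_blinear u = avg mu c u.
Proof.
apply/funext => x; rewrite /= /finrank (bigD1_seq (c x)) ?enum_uniq ?mem_enum//=.
rewrite indicE mem_set// mulr1 big1 ?addr0// => t tx.
by rewrite indicE memNset ?mulr0// => /= xt; rewrite xt eqxx in tx.
Qed.

Lemma compact_avg : compact_operator (lift_parts (V := V) avg_blinear).
Proof. by apply: compact_finrank; exact: cell_avg_le. Qed.

End average_operator.

(** An injection of [G] into [nat] is inverted; integers outside its image are sent to [set0], which
    generates nothing new. *)
Lemma countably_generated_seq d (E : measurableType d) : countably_generated E ->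
  exists G : nat -> set E, @measurable d E = <<s range G >>.
Proof.
move=> [G /countable_injP[g ginj] GE].
pose F n : set E := if pselect (exists2 A, G A & g A = n) is left h
  then projT1 (cid2 h) else set0.
exists F; rewrite GE; apply/seteqP; split.
  apply: smallest_sub; first exact: smallest_sigma_algebra.
  move=> A GA; apply: sub_sigma_algebra; exists (g A) => //.
  rewrite /F; case: pselect => [h|[]]; last by exists A.
  by case: cid2 => B GB gB /=; apply: ginj => //; rewrite inE.
apply: smallest_sub; first exact: smallest_sigma_algebra.
move=> _ [n _ <-]; rewrite /F; case: pselect => [h|_]; last first.
  exact: sigma_algebra0.
by case: cid2 => A GA _ /=; exact: sub_sigma_algebra.
Qed.

(** * From uniform vanishing to compact approximation *)

Section upper_bound.
Context d (E : measurableType d) (R : realType) (V : weight E R).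

(** The index [n] is chosen after [l]: the distance only sees the norm of [(S D_n)^l], whose bound
    has a constant free of both. The real and imaginary parts together give [2 * L]. *)
Lemma compact_dist_iter_le (N : R.-fker E ~> E) b : countably_generated E -> 0 < b ->
  uniformly_vanishing N b -> exists L, forall l,
    compact_dist (iter l (lift_parts (V := V) (kernel_mean_blinear N))) <= L * (4 * b) ^+ l.
Proof.
move=> /countably_generated_seq[G GE] b0 Nb.
have [s [M [M0 domN]]] := uniformly_vanishing_dominated (ltW b0) Nb.
have [mu [K [K0 smu excN]]] := excessive_measure N s.
have domN' x A : measurable A -> (N x A <= M%:E * mu A + b%:E)%E.
  move=> mA; rewrite (le_trans (domN x A mA))// leeD2r// lee_wpmul2l ?lee_fin//.
  exact: smu.
have [L L0 hL] := exists_iter_mean_resid_le GE M0 K0 b0 domN' excN.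
exists (2 * L) => l; have [n hn] := hL l.
pose A := avg_blinear mu (fun t => measurable_code GE (n := n) t).
pose S := lift_parts (V := V) (kernel_mean_blinear N) : {linear Linfty V -> Linfty V}.
pose LA := lift_parts (V := V) A : {linear Linfty V -> Linfty V}.
have cA : compact_operator LA by exact: compact_avg.
have [C C0 SC] := kernel_mean_blinear_bounded N.
have C20 : 0 <= 2 * C by rewrite mulr_ge0.
have Sb : bounded_by S (2 * C) := lift_bounded SC.
have [CA CA0 Ab] := compact_operator_bounded cA.
pose SD : {linear Linfty V -> Linfty V} := S \o (idfun \- LA : {linear Linfty V -> Linfty V}).
have SDb : bounded_by SD (2 * C * (1 + CA)).
  move=> f; rewrite /= (le_trans (Sb _))// -[leRHS]mulrA ler_wpM2l//.
  by rewrite (le_trans (ler_nrmB _ _))// mulrDl mul1r lerD2l; exact: Ab.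
have SDb0 : 0 <= 2 * C * (1 + CA) by rewrite mulr_ge0// addr_ge0.
have SDE f : SD f = S (f - LA f) by [].
have rSD k f : rpart (iter k SD f) = iter k (mean_resid N G mu n) (rpart f) /\
               ipart (iter k SD f) = iter k (mean_resid N G mu n) (ipart f).
  have e u : (fun y => u y + - A u y) = gen_resid G mu n u.
    by apply/funext => y; rewrite avg_blinearE.
  elim: k => //= k [<- <-]; split.
    by rewrite rpart_lift rpartD rpartN rpart_lift/= e.
  by rewrite ipart_lift ipartD ipartN ipart_lift/= e.
(* S^(l+1) - (S D)^(l+1) = S (S^l - (S D)^l) + S A (S D)^l *)
have [Kl [cKl KlE]] : exists Kl : {linear Linfty V -> Linfty V},
    compact_operator Kl /\ forall f, iter l S f - Kl f = iter l SD f.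
  elim: l {hn} => [|l [Kl [cKl KlE]]].
    by exists \0; split; [exact: compact_operator0|move=> f; rewrite /= subr0].
  exists ((S \o Kl : {linear Linfty V -> Linfty V}) \+
    ((S \o LA : {linear Linfty V -> Linfty V}) \o iter_lin SD l : {linear Linfty V -> Linfty V})).
  split.
    apply: compact_operatorD; first exact: (compact_operator_compl C20 Sb).
    apply: (compact_operator_compr (M := (2 * C * (1 + CA)) ^+ l)).
    - by rewrite exprn_ge0.
    - by move=> f; rewrite iter_linE; exact: iter_bounded_by.
    - exact: (compact_operator_compl C20 Sb).
  move=> f; have -> : iter l.+1 SD f = S (iter l SD f - LA (iter l SD f)) by [].
  have -> : S (iter l SD f - LA (iter l SD f)) =
      S (iter l S f) - S (Kl f) - S (LA (iter l SD f)).
    by rewrite raddfB -[in X in X - _]KlE raddfB.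
  by rewrite /= iter_linE opprD addrA.
rewrite (le_trans (compact_dist_le _ cKl))//.
apply: opnorm_le_ball => f f1; rewrite KlE.
have -> : 2 * L * (4 * b) ^+ l = L * (4 * b) ^+ l + L * (4 * b) ^+ l by ring.
have [rE iE] := rSD l f.
apply: nrm_le_parts => y.
  rewrite rE; apply: hn; first exact: bmeas_rpart.
  by move=> x; exact: le_trans (rpart_le _ _) f1.
rewrite iE; apply: hn; first exact: bmeas_ipart.
by move=> x; exact: le_trans (ipart_le _ _) f1.
Qed.

End upper_bound.

(** * Comparison of the two kernels *)

Section lower_bound.
Context d (E : measurableType d) (R : realType) (V : weight E R).

Lemma opnorm_ball_le (B : normedModType R[i]) (T : B -> B) M f : 0 <= M ->
  bounded_by T M -> nrm f <= 1 -> nrm (T f) <= opnorm T.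
Proof.
move=> M0 TM f1; apply: sup_upper_bound; first exact: opnorm_has_sup TM.
by rewrite nball1E; exists f.
Qed.

Lemma kernel_meanE (N : R.-fker E ~> E) A x : measurable A ->
  (kernel_mean N \1_A x)%:E = N x A.
Proof.
move=> mA; rewrite /kernel_mean /Rintegral integral_indic// setIT fineK//.
exact: fker_fin_num.
Qed.

Lemma compact_dist_uniformly_vanishing (N : R.-fker E ~> E)
    (T : Linfty V -> Linfty V) M b : 0 <= M -> bounded_by T M ->
  (forall f, rpart (T f) = kernel_mean N (rpart f)) ->
  2 * compact_dist T < b -> uniformly_vanishing N b.
Proof.
move=> M0 TM TN Tb A [mA niA A0].
(* The final count is [2 * dl + 3 * e] with [dl < compact_dist T + e], below
   [b = 2 * compact_dist T + 8 * e]. *)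
pose e := (b - 2 * compact_dist T) / 8.
have e0 : 0 < e by rewrite divr_gt0// subr_gt0.
have [K cK hK] := compact_dist_adherent T e0.
set dl := opnorm _ in hK.
have [MK MK0 KM] := compact_operator_bounded cK.
have b0 := bmeas_cst E (0 : R).
pose f j : Linfty V := of_parts V (bmeas_indic R (mA j)) b0.
have rf j : rpart (f j) = \1_(A j) by exact: rpart_of_parts.
have f1 j : nrm (f j) <= 1.
  rewrite -[1]addr0; apply: nrm_le_parts => y.
    by rewrite rf indicE ger0_norm ?ler0n// lern1 leq_b1.
  by rewrite ipart_of_parts normr0.
pose p j x := kernel_mean N \1_(A j) x.
have p0 j x : 0 <= p j x.
  by apply: Rintegral_ge0 => y _; rewrite indicE ler0n.
have pK j x : `|p j x - rpart (K (f j)) x| <= dl.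
  have -> : p j x - rpart (K (f j)) x = rpart (T (f j) - K (f j)) x.
    by rewrite rpartD rpartN TN rf.
  rewrite (le_trans (rpart_le _ _))//.
  apply: (opnorm_ball_le (T := fun g => T g - K g) (addr_ge0 M0 MK0)) => // g.
  by rewrite (le_trans (ler_nrmB _ _))// mulrDl lerD.
have pcvg x : (fun j => p j x) @ \oo --> 0.
  have : N x \o A @ \oo --> 0%E.
    rewrite -(measure0 (N x)) -A0; apply: nonincreasing_cvg_mu => //.
    - by rewrite -ge0_fin_numE//; exact: fker_fin_num.
    - by rewrite A0.
  have -> : N x \o A = (fun j => (p j x)%:E) by apply/funext => j; rewrite kernel_meanE.
  by move=> /fine_cvgP[].
have /compact_operatorP[C cC KC] := cK.
have [|g [Cg clg]] := cC ((fun j => K (f j)) @ \oo) _.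
  by exists 0%N => // j _; exact: KC.
have near_g J : exists2 j, (J <= j)%N & nrm (K (f j) - g) < e.
  have FJ : ((fun j => K (f j)) @ \oo) [set K (f j) | j in [set j | (J <= j)%N]].
    by exists J => // j Jj; exists j.
  have ng : nbhs g [set h : Linfty V | nrm (h - g) < e].
    apply/nbhs_ballP; exists (e%:C)%C; first by rewrite /= -[0]/(0%:C)%C ltcR.
    by move=> h; rewrite -ball_normE /= nrmE ltcR -nrmN opprB.
  by have [_ [[j Jj <-] h]] := clg _ _ FJ ng; exists j.
have rB (h1 h2 : Linfty V) x : `|rpart h1 x - rpart h2 x| <= nrm (h1 - h2).
  by rewrite (le_trans _ (rpart_le _ x))// rpartD rpartN.
(* Here [j] depends on [x]: it is large enough for [p j x < e], and chosen among the infinitely many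
   for which [K (f j)] is close to [g]. The resulting bound on [g] no longer involves [j]. *)
have g_le x : `|rpart g x| <= dl + 2 * e.
  have /cvgrPdist_lt /(_ _ e0)[J _ hJ] := pcvg x.
  have [j Jj jg] := near_g J.
  have := hJ j Jj; rewrite sub0r normrN => pj.
  have := pK j x; have := rB (K (f j)) g x.
  have := ltW jg; move: pj.
  rewrite !ltr_norml !ler_norml => /andP[? ?] ? /andP[? ?] /andP[? ?].
  by apply/andP; split; lra.
(* A single [j] now serves all [x], since [K (f j)] is close to [g] in norm. *)
have [j _ jg] := near_g 0%N.
exists j => x; rewrite -kernel_meanE// lee_fin.
have := pK j x; have := rB (K (f j)) g x; have := g_le x.
have := ltW jg; have := hK.
have : b = 2 * compact_dist T + 8 * e by rewrite /e; field.
rewrite -/(p j x) !ler_norml => ? ? ? /andP[? ?] /andP[? ?] /andP[? ?].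
lra.
Qed.

Lemma le_kpow (N1 N2 : R.-fker E ~> E) :
  (forall x A, measurable A -> (N1 x A <= N2 x A)%E) ->
  forall n x A, measurable A -> (kpow N1 n x A <= kpow N2 n x A)%E.
Proof.
move=> N12; elim=> // n IH x A mA.
have -> : kpow N1 n.+1 x A = (\int[kpow N1 n x]_y N1 y A)%E by [].
have -> : kpow N2 n.+1 x A = (\int[kpow N2 n x]_y N2 y A)%E by [].
rewrite (@le_trans _ _ (\int[kpow N1 n x]_y N2 y A)%E)//.
  apply: ge0_le_integral => //; [exact: measurable_kernel|exact: measurable_kernel|].
  by move=> y _; exact: N12.
apply: ge0_le_measure_integral => //; last exact: measurable_kernel.
by move=> B mB; exact: IH.
Qed.

Lemma le_uniformly_vanishing (N1 N2 : R.-fker E ~> E) b :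
  (forall x A, measurable A -> (N1 x A <= N2 x A)%E) ->
  uniformly_vanishing N2 b -> uniformly_vanishing N1 b.
Proof.
move=> N12 N2b A vA; have [mA _ _] := vA; have [n hn] := N2b A vA.
by exists n => x; rewrite (le_trans _ (hn x))// N12.
Qed.

Lemma iter_kop (k : R.-sigmafker E ~> E) (kV : kernel_to_Linfty V k) n :
  iter n.+1 (kop kV) = lift_parts (V := V) (kernel_mean_blinear (kpow (normalized_kernel kV) n)).
Proof.
have E1 : (kop kV : Linfty V -> Linfty V) = lift_parts (kernel_mean_blinear (normalized_kernel kV)).
  by apply/funext => f; exact: kop_lift.
apply/funext => f; apply: Linfty_ext => x.
  rewrite rpart_lift E1 rpart_iter_lift /= kernel_mean_kpow//; exact: bmeas_rpart.
by rewrite ipart_lift E1 ipart_iter_lift /= kernel_mean_kpow//; exact: bmeas_ipart.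
Qed.

Lemma kop_bounded (k : R.-sigmafker E ~> E) (kV : kernel_to_Linfty V k) :
  exists2 M, 0 <= M & bounded_by (kop kV) M.
Proof.
have [C C0 NC] := kernel_mean_blinear_bounded (normalized_kernel kV).
exists (2 * C); first by rewrite mulr_ge0.
by move=> f; rewrite kop_lift; exact: lift_bounded.
Qed.

(** The order of the operators is tested on [V * \1_A], whose image divided by [V] is the normalized
    measure of [A]. *)
Lemma le_normalized_kernel (P Q : R.-sigmafker E ~> E)
    (hP : kernel_to_Linfty V P) (hQ : kernel_to_Linfty V Q) :
  (forall f : Linfty V, (forall x, 0 <= f x) ->
    forall x, 0 <= kop hP f x /\ kop hP f x <= kop hQ f x) ->
  forall x A, measurable A -> (normalized_kernel hP x A <= normalized_kernel hQ x A)%E.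
Proof.
move=> hPQ x A mA; rewrite -!kernel_meanE// lee_fin.
have b0 := bmeas_cst E (0 : R).
pose f : Linfty V := of_parts V (bmeas_indic R mA) b0.
have f0 y : 0 <= f y.
  by rewrite lecE/= mulr0 eqxx/= mulr_ge0 ?(ltW (weight_gt0 _ _))//.
have [_] := hPQ f f0 x; rewrite lecE => /andP[_ le].
have rf : rpart f = \1_A by exact: rpart_of_parts.
have h k (hk : kernel_to_Linfty V k) : kernel_mean (normalized_kernel hk) \1_A x = rpart (kop hk f) x.
  by rewrite kop_lift rpart_lift/= rf.
by rewrite !h /rpart ler_pM2r// invr_gt0 weight_gt0.
Qed.

End lower_bound.

Theorem corollary4 (d : measure_display) (E : measurableType d) (R : realType)
    (hE : countably_generated E) (V : weight E R)
    (P Q : R.-sigmafker E ~> E)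
    (hP : kernel_to_Linfty V P) (hQ : kernel_to_Linfty V Q)
    (hPQ : forall f : Linfty V, (forall x, 0 <= f x) ->
       forall x, 0 <= kop hP f x /\ kop hP f x <= kop hQ f x) :
  ess_spectral_radius (kop hP) <= ess_spectral_radius (kop hQ).
Proof.
have [MP MP0 PM] := kop_bounded hP; have [MQ MQ0 QM] := kop_bounded hQ.
(* The positive exponent is renamed [m.+1], to match [kpow _ m], the power of order [m + 1]. *)
apply: (le_ess_spectral_radius MP0 MQ0 PM QM) => -[//|m] b _ mb.
have b0 : 0 < b by rewrite (le_lt_trans _ mb)// mulr_ge0// compact_dist_ge0.
have Qb : uniformly_vanishing (kpow (normalized_kernel hQ) m) b.
  apply: (compact_dist_uniformly_vanishing (M := MQ ^+ m.+1)) mb.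
  - by rewrite exprn_ge0.
  - by move=> f; exact: iter_bounded_by.
  - by move=> f; rewrite iter_kop rpart_lift.
have Pb : uniformly_vanishing (kpow (normalized_kernel hP) m) b.
  by apply: le_uniformly_vanishing Qb; apply: le_kpow; exact: le_normalized_kernel.
have [L hL] := compact_dist_iter_le V hE b0 Pb.
exists L => k; rewrite (_ : iter (m.+1 * k) (kop hP) =
  iter k (lift_parts (V := V) (kernel_mean_blinear (kpow (normalized_kernel hP) m)))) //.
rewrite -iter_kop; apply/funext => f; elim: k => [|k IH]; first by rewrite muln0.
by rewrite mulnS iterD IH iterS.
Qed.
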